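(* In the power series completion $\prod_{n\geq0}\mathbb{A}^n$ of the algebra $\mathbb{A}^\bullet$ of colored trivalent graphs the generating series of the normalized moment polynomials $(\Psi^\circ_n)_{n\in\mathbb{N}_0}$ can be written as the exponential of a sum over all isomorphism classes of connected colored trivalent graphs $\gamma$ with the additional property that all cycles of the black subgraph $\gamma_{\mathrm{black}}$ have even length: $$\sum_{n\geq0}\Psi^\circ_n\;=\;\exp\Big(\sum_{\substack{[\gamma]\in\Gamma^\bullet_{\mathrm{conn}}\\ \text{all cycles of }\gamma_{\mathrm{black}}\text{ even}}}(-1)^{n(\gamma)}\;\frac{2^{g(\gamma)}}{\#\overline{\mathrm{Aut}}\,\gamma}\;[\gamma]\Big),$$ where $n(\gamma):=\frac12\,\#\mathrm{Vert}\,\gamma$ and $g(\gamma)$ is the number of cycles of $\gamma_{\mathrm{black}}$ of length greater than $2$.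
   Context: Graphs. A finite graph $\gamma$ consists of finite sets $\mathrm{Vert}\,\gamma$ of vertices and $\mathrm{Flag}\,\gamma$ of flags (half-edges), a fixed point free involution $\theta$ of $\mathrm{Flag}\,\gamma$ and an attaching map $\mathrm{Flag}\,\gamma\to\mathrm{Vert}\,\gamma$; the edges are the orbits of $\theta$. Loops and multiple edges are allowed. A colored trivalent graph is such a graph in which every vertex has exactly three flags, with a $\theta$-invariant coloring of the flags in red and black such that every vertex is adjacent to exactly one red flag. The black subgraph $\gamma_{\mathrm{black}}$ is obtained by removing all red edges; it is bivalent and hence a disjoint union of cycles of length $\geq1$ (a loop is a cycle of length $1$, a pair of parallel black edges a cycle of length $2$). Isomorphisms are pairs of bijections of vertices and flags compatible with the involutions, attaching maps and colorings. $\overline{\mathrm{Aut}}\,\gamma$ is the group of permutations of $\mathrm{Vert}\,\gamma$ induced by the automorphisms of the colored graph $\gamma$. $\Gamma^n$ is the set of isomorphism classes of colored trivalent graphs with $2n$ vertices, $\Gamma^\bullet=\bigcup_n\Gamma^n$ is a graded commutative monoid under disjoint union (the class of the empty graph being the unit), and $\Gamma^\bullet_{\mathrm{conn}}\subseteq\Gamma^\bullet$ is the subset of classes of (non-empty) connected graphs. The algebra of colored trivalent graphs is the monoid algebra $\mathbb{A}^\bullet:=\mathbb{R}\,\Gamma^\bullet$, graded by $\mathbb{A}^n:=\mathbb{R}\,\Gamma^n$. Normalized moment polynomials. As polynomials in algebraic curvature tensors $R$ on a euclidean vector space $(T,g)$ they are the components $\Psi^\circ_n(R)$ of degree $n$ in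 $R$ of $$\sum_{n\geq0}\Psi^\circ_n(R):=\exp(-\Delta_g)\big|_0\Big(X\mapsto\exp\Big(\sum_{r>0}\frac1{2r}\mathrm{tr}\big((R_{\,\cdot\,,X}X)^r\big)\Big)\Big),\qquad \Delta_g=-\sum_\mu\frac{\partial^2}{\partial x_\mu^2},$$ where $R_{\,\cdot\,,X}X$ is the endomorphism $U\mapsto R_{U,X}X$. A colored trivalent graph evaluates on $R$ by summing over an orthonormal basis for each black edge and taking, for each red edge with ends $v_\pm$, a factor $\mathrm{Sec}(\cdot,\cdot;\cdot,\cdot)$ whose first (second) pair of arguments are the basis vectors on the black flags at $v_+$ (at $v_-$), where $\mathrm{Sec}(X,Y;U,V)=-2(R(X,U;Y,V)+R(X,V;Y,U))$. With this evaluation the polynomials $\Psi^\circ_n$ are represented by the following elements of $\mathbb{A}^n$, also denoted $\Psi^\circ_n$, which are the ones meant in the claim: $$\sum_{n\geq0}\Psi^\circ_n:=\mathrm{closure}\Big[\exp\Big(\sum_{r>0}\frac{(-1)^r}{2r}\,C_r\Big)\Big].$$ Here $C_r$ is the cycle with $2r$ vertices whose $2r$ edges are alternately red and black and in which each vertex carries in addition one open (unpaired) black flag; for $r=1$ it consists of two vertices joined by one red and one black edge. Products are disjoint unions, and the linear operation $\mathrm{closure}$ sends a disjoint union of such cycles to the sum, over all fixed point free involutions of its set of vertices (i.e. all perfect matchings of the open flags), of the class of the colored trivalent graph obtained by joining the matched open flags by black edges. *)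

(* Defs.v *)
From HB Require Import structures.
From mathcomp Require Import all_boot all_order all_algebra finmap.
From mathcomp Require Import fingroup perm generic_quotient.
From mathcomp.multinomials Require Import monalg.
From mathcomp Require Import boolp reals.

Set Implicit Arguments.
Unset Strict Implicit.
Unset Printing Implicit Defensive.

Import GRing.Theory.
Local Open Scope ring_scope.
Local Open Scope quotient_scope.

Record flag_graph (V F : finType) := FlagGraph {
  theta : {ffun F -> F};
  attach : {ffun F -> V};
  red : {set F} }.

Section FlagGraphFinite.
Variables V F : finType.

Definition flag_graph_code (G : flag_graph V F) := (theta G, attach G, red G).
Definition flag_graph_decode (x : {ffun F -> F} * {ffun F -> V} * {set F}) :=
  FlagGraph x.1.1 x.1.2 x.2.

Lemma flag_graph_codeK : cancel flag_graph_code flag_graph_decode.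
Proof. by case. Qed.

HB.instance Definition _ :=
  Finite.copy (flag_graph V F) (can_type flag_graph_codeK).
End FlagGraphFinite.

(* A flag fixed by [theta] is an open, that is unpaired, flag.  For            *)
(* [o = false] there are none and [theta] is a fixed point free involution;    *)
(* for [o = true] black flags may be open.                                     *)
Definition colored_trivalent (o : bool) (V F : finType) (G : flag_graph V F) :=
  [&& [forall f, theta G (theta G f) == f],
      [forall f, (theta G f == f) ==> o && (f \notin red G)],
      [forall f, (theta G f \in red G) == (f \in red G)],
      [forall v, #|[set f | attach G f == v]| == 3%N] &
      [forall v, #|[set f in red G | attach G f == v]| == 1%N]].

Record ctgraph (o : bool) (V F : finType) := CTGraph {
  ctval :> flag_graph V F;
  ctvalP : colored_trivalent o ctval }.

HB.instance Definition _ o V F := [isSub for @ctval o V F].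
HB.instance Definition _ o V F := [Finite of ctgraph o V F by <:].

Lemma colored_trivalentP (o : bool) (V F : finType) (G : flag_graph V F) :
  reflect [/\ forall f, theta G (theta G f) = f,
              forall f, theta G f = f -> o /\ f \notin red G,
              forall f, (theta G f \in red G) = (f \in red G),
              forall v, #|[set f | attach G f == v]| = 3%N &
              forall v, #|[set f in red G | attach G f == v]| = 1%N]
          (colored_trivalent o G).
Proof.
apply: (iffP and5P) => [[H1 H2 H3 H4 H5]|[H1 H2 H3 H4 H5]]; split.
- by move=> f; apply/eqP/(forallP H1).
- by move=> f /eqP ff; apply/andP/(implyP (forallP H2 f)).
- by move=> f; apply/eqP/(forallP H3).
- by move=> v; apply/eqP/(forallP H4).
- by move=> v; apply/eqP/(forallP H5).
- by apply/forallP => f; rewrite H1.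
- by apply/forallP => f; apply/implyP => /eqP /H2 /andP.
- by apply/forallP => f; rewrite H3.
- by apply/forallP => f; rewrite H4.
- by apply/forallP => f; rewrite H5.
Qed.

Definition is_morph (V F V' F' : finType) (G : flag_graph V F)
    (H : flag_graph V' F') (fv : V -> V') (ff : F -> F') :=
  [&& [forall f, ff (theta G f) == theta H (ff f)],
      [forall f, fv (attach G f) == attach H (ff f)] &
      [forall f, (ff f \in red H) == (f \in red G)]].

Lemma is_morphP (V F V' F' : finType) (G : flag_graph V F)
    (H : flag_graph V' F') (fv : V -> V') (ff : F -> F') :
  reflect [/\ forall f, ff (theta G f) = theta H (ff f),
              forall f, fv (attach G f) = attach H (ff f) &
              forall f, (ff f \in red H) = (f \in red G)]
          (is_morph G H fv ff).
Proof.
by apply: (iffP and3P) => -[H1 H2 H3]; split;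
  [move=> f; apply/eqP/(forallP H1) | move=> f; apply/eqP/(forallP H2)
  |move=> f; apply/eqP/(forallP H3) | apply/forallP => f; rewrite H1
  |apply/forallP => f; rewrite H2 | apply/forallP => f; rewrite H3].
Qed.

Definition iso (V F V' F' : finType) (G : flag_graph V F)
    (H : flag_graph V' F') : Prop :=
  exists (fv : V -> V') (ff : F -> F'),
    [/\ bijective fv, bijective ff & is_morph G H fv ff].

Lemma iso_refl (V F : finType) (G : flag_graph V F) : iso G G.
Proof.
exists id, id; split; [by exists id | by exists id |].
by apply/is_morphP.
Qed.

Lemma iso_sym (V F V' F' : finType) (G : flag_graph V F)
  (H : flag_graph V' F') : iso G H -> iso H G.
Proof.
case=> fv [ff] [[gv fvK gvK] [gf ffK gfK] /is_morphP [H1 H2 H3]].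
exists gv, gf; split; [by exists fv | by exists ff | apply/is_morphP; split].
- by move=> f; apply: (can_inj ffK); rewrite H1 !gfK.
- by move=> f; apply: (can_inj fvK); rewrite H2 !gfK gvK.
- by move=> f; rewrite -H3 gfK.
Qed.

Lemma iso_trans (V F V' F' V'' F'' : finType) (G : flag_graph V F)
    (H : flag_graph V' F') (K : flag_graph V'' F'') :
  iso G H -> iso H K -> iso G K.
Proof.
case=> fv [ff] [bv bf /is_morphP [H1 H2 H3]].
case=> gv [gf] [cv cf /is_morphP [K1 K2 K3]].
exists (gv \o fv), (gf \o ff).
split; [exact: bij_comp | exact: bij_comp | apply/is_morphP; split] => f /=.
- by rewrite H1 K1.
- by rewrite H2 K2.
- by rewrite K3 H3.
Qed.

Section Transport.
Variables (o : bool) (V F V' F' : finType).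
Variables (fv : V -> V') (gv : V' -> V) (ff : F -> F') (gf : F' -> F).
Hypotheses (fvK : cancel fv gv) (gvK : cancel gv fv).
Hypotheses (ffK : cancel ff gf) (gfK : cancel gf ff).

Definition transport_graph (G : flag_graph V F) : flag_graph V' F' :=
  FlagGraph [ffun f => ff (theta G (gf f))] [ffun f => fv (attach G (gf f))]
            [set f | gf f \in red G].

Lemma transport_proof (G : ctgraph o V F) :
  colored_trivalent o (transport_graph G).
Proof.
have /colored_trivalentP [H1 H2 H3 H4 H5] := ctvalP G.
apply/colored_trivalentP; split => /=.
- by move=> f; rewrite !ffunE ffK H1 gfK.
- by move=> f; rewrite ffunE inE => E; apply: H2; rewrite -{2}E ffK.
- by move=> f; rewrite !inE ffunE ffK H3.
- move=> v; rewrite -(H4 (gv v)) -(card_imset _ (can_inj ffK)).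
  congr #|pred_of_set _|; apply/setP => f; rewrite inE ffunE.
  apply/eqP/imsetP => [E|[x]].
    by exists (gf f); rewrite ?gfK // inE -E fvK.
  by rewrite inE => /eqP E ->; rewrite ffK E gvK.
- move=> v; rewrite -(H5 (gv v)) -(card_imset _ (can_inj ffK)).
  congr #|pred_of_set _|; apply/setP => f; rewrite !inE ffunE.
  apply/andP/imsetP => [[r /eqP E]|[x]].
    by exists (gf f); rewrite ?gfK // inE r -E fvK /=.
  by rewrite inE => /andP [r /eqP E] ->; rewrite ffK E gvK.
Qed.

Definition transport G : ctgraph o V' F' := CTGraph (transport_proof G).

Lemma transport_iso (G : ctgraph o V F) : iso G (transport G).
Proof.
exists fv, ff; split; [by exists gv | by exists gf | apply/is_morphP].
by split=> f /=; rewrite ?ffunE ?inE ffK.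
Qed.
End Transport.

Definition empty_graph : flag_graph void void :=
  FlagGraph [ffun f => f] [ffun f => f] set0.

Lemma empty_proof o : colored_trivalent o empty_graph.
Proof. by apply/colored_trivalentP; split; case. Qed.

Definition ctempty o : ctgraph o void void := CTGraph (empty_proof o).

Section DisjointUnion.
Variables (o : bool) (V1 F1 V2 F2 : finType).

Definition union_graph (G : flag_graph V1 F1) (H : flag_graph V2 F2) :
    flag_graph (V1 + V2)%type (F1 + F2)%type :=
  FlagGraph
    [ffun f => match f with
               | inl x => inl (theta G x) | inr y => inr (theta H y) end]
    [ffun f => match f with
               | inl x => inl (attach G x) | inr y => inr (attach H y) end]
    [set f | match f with inl x => x \in red G | inr y => y \in red H end].

Lemma card_set_inl (A : {set F1 + F2}) (B : {set F1}) :
  (forall x, (inl x \in A) = (x \in B)) -> (forall y, inr y \notin A) ->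
  #|A| = #|B|.
Proof.
move=> HB HN; rewrite -(card_imset (mem B) (@inl_inj F1 F2)).
congr #|pred_of_set _|; apply/setP => -[x|y].
  by rewrite HB mem_imset //; apply: inl_inj.
rewrite (negbTE (HN y)); apply/esym/negbTE/negP.
by case/imsetP.
Qed.

Lemma card_set_inr (A : {set F1 + F2}) (B : {set F2}) :
  (forall y, (inr y \in A) = (y \in B)) -> (forall x, inl x \notin A) ->
  #|A| = #|B|.
Proof.
move=> HB HN; rewrite -(card_imset (mem B) (@inr_inj F1 F2)).
congr #|pred_of_set _|; apply/setP => -[x|y].
  rewrite (negbTE (HN x)); apply/esym/negbTE/negP.
  by case/imsetP.
by rewrite HB mem_imset //; apply: inr_inj.
Qed.

Lemma union_proof (G : ctgraph o V1 F1) (H : ctgraph o V2 F2) :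
  colored_trivalent o (union_graph G H).
Proof.
have /colored_trivalentP [G1 G2 G3 G4 G5] := ctvalP G.
have /colored_trivalentP [H1 H2 H3 H4 H5] := ctvalP H.
apply/colored_trivalentP; split => /=.
- by case=> f; rewrite !ffunE ?G1 ?H1.
- by case=> f; rewrite !ffunE inE => -[]; (exact: G2 || exact: H2).
- by case=> f; rewrite !inE ffunE ?G3 ?H3.
- case=> v; [rewrite -(G4 v); apply: card_set_inl
            |rewrite -(H4 v); apply: card_set_inr] => f;
  by rewrite !inE ?ffunE.
- case=> v; [rewrite -(G5 v); apply: card_set_inl
            |rewrite -(H5 v); apply: card_set_inr] => f;
  by rewrite !inE ?ffunE // andbF.
Qed.

Definition ctunion (G : ctgraph o V1 F1) (H : ctgraph o V2 F2) :=
  CTGraph (union_proof G H).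
End DisjointUnion.

(* The quotient is formed on graphs carried by standard finite sets, so that  *)
(* it is a small type; [gclass G] is the class of an arbitrary graph.         *)
Definition std_graph (o : bool) :=
  {nm : nat * nat & ctgraph o 'I_nm.1 'I_nm.2}.
HB.instance Definition _ o := Choice.on (std_graph o).

Definition iso_rel o : rel (std_graph o) :=
  fun G H => `[< iso (tagged G) (tagged H) >].

Lemma iso_rel_refl o : reflexive (@iso_rel o).
Proof. by move=> G; apply/asboolP/iso_refl. Qed.
Lemma iso_rel_sym o : symmetric (@iso_rel o).
Proof. by move=> G H; apply/asboolP/asboolP; apply: iso_sym. Qed.
Lemma iso_rel_trans o : transitive (@iso_rel o).
Proof.
move=> H G K /asboolP GH /asboolP HK; apply/asboolP.
exact: iso_trans GH HK.
Qed.

Canonical iso_equiv o :=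
  EquivRel (@iso_rel o) (@iso_rel_refl o) (@iso_rel_sym o) (@iso_rel_trans o).

Definition graph_class (o : bool) := {eq_quot (iso_equiv o)}.
HB.instance Definition _ o := Choice.on (graph_class o).

Definition std o (V F : finType) (G : ctgraph o V F) : std_graph o :=
  Tagged (fun nm : nat * nat => ctgraph o 'I_nm.1 'I_nm.2) (i := (#|V|, #|F|))
    (transport (@enum_rankK V) (@enum_valK V) (@enum_rankK F) (@enum_valK F) G).

Definition gclass o (V F : finType) (G : ctgraph o V F) : graph_class o :=
  \pi_({eq_quot (iso_equiv o)}) (std G).

Definition rep_std o (c : graph_class o) : std_graph o :=
  repr (c : {eq_quot (iso_equiv o)}).
Definition nvert o (c : graph_class o) : nat := (tag (rep_std c)).1.
Definition nflag o (c : graph_class o) : nat := (tag (rep_std c)).2.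
Definition rep o (c : graph_class o) : ctgraph o 'I_(nvert c) 'I_(nflag c) :=
  tagged (rep_std c).

Lemma std_iso o (V F : finType) (G : ctgraph o V F) : iso G (tagged (std G)).
Proof. exact: transport_iso. Qed.

Lemma gclassP o (V F V' F' : finType) (G : ctgraph o V F)
    (H : ctgraph o V' F') : gclass G = gclass H <-> iso G H.
Proof.
split=> [/eqP|GH].
  rewrite /gclass eqmodE /= => /asboolP E.
  exact: (iso_trans (std_iso G) (iso_trans E (iso_sym (std_iso H)))).
apply/eqP; rewrite /gclass eqmodE /=; apply/asboolP.
exact: (iso_trans (iso_sym (std_iso G)) (iso_trans GH (std_iso H))).
Qed.

Lemma gclass_rep o (c : graph_class o) : gclass (rep c) = c.
Proof.
apply: (etrans _ (reprK (c : {eq_quot (iso_equiv o)}))).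
apply/eqP; rewrite /gclass eqmodE /=; apply/asboolP.
exact: iso_sym (std_iso (rep c)).
Qed.

Lemma rep_gclass o (V F : finType) (G : ctgraph o V F) : iso G (rep (gclass G)).
Proof. by apply/gclassP; rewrite gclass_rep. Qed.

Lemma nvert_gclass o (V F : finType) (G : ctgraph o V F) :
  nvert (gclass G) = #|V|.
Proof.
case: (rep_gclass G) => fv [ff] [bv _ _].
by rewrite (bij_eq_card bv) card_ord.
Qed.

Lemma union_iso o (V1 F1 V2 F2 V3 F3 V4 F4 : finType)
    (G : ctgraph o V1 F1) (H : ctgraph o V2 F2)
    (G' : ctgraph o V3 F3) (H' : ctgraph o V4 F4) :
  iso G G' -> iso H H' -> iso (ctunion G H) (ctunion G' H').
Proof.
case=> fv [ff] [[fv' fvK fvK'] [ff' ffK ffK'] /is_morphP [G1 G2 G3]].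
case=> hv [hf] [[hv' hvK hvK'] [hf' hfK hfK'] /is_morphP [H1 H2 H3]].
pose smap (A B C D : Type) (u : A -> B) (v : C -> D) (x : A + C) : B + D :=
  match x with inl a => inl (u a) | inr c => inr (v c) end.
exists (smap _ _ _ _ fv hv), (smap _ _ _ _ ff hf); split.
- by exists (smap _ _ _ _ fv' hv') => -[x|x] /=; congr (_ _).
- by exists (smap _ _ _ _ ff' hf') => -[x|x] /=; congr (_ _).
- by apply/is_morphP; split=> -[x|x] /=; rewrite ?ffunE ?inE /= ?G1 ?G2 ?H1 ?H2.
Qed.

Definition gc1 o : graph_class o := gclass (ctempty o).
Definition gcmul o (c d : graph_class o) : graph_class o :=
  gclass (ctunion (rep c) (rep d)).

Lemma gcmulE o (V1 F1 V2 F2 : finType) (G : ctgraph o V1 F1)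
    (H : ctgraph o V2 F2) : gcmul (gclass G) (gclass H) = gclass (ctunion G H).
Proof. by apply/gclassP/union_iso; apply/iso_sym/rep_gclass. Qed.

Lemma gcmulC o : commutative (@gcmul o).
Proof.
move=> c d; apply/gclassP.
pose swap (A B : Type) (x : A + B) : B + A :=
  match x with inl a => inr a | inr b => inl b end.
exists (@swap _ _), (@swap _ _); split; try by exists (@swap _ _); case.
by apply/is_morphP; split=> -[x|x]; rewrite /= ?ffunE ?inE.
Qed.

Lemma gcmul1c o : left_id (gc1 o) (@gcmul o).
Proof.
move=> c; rewrite -[c in LHS]gclass_rep gcmulE -[RHS]gclass_rep.
apply/gclassP/iso_sym; exists inr, inr.
have binr (A : Type) : bijective (@inr void A).
  by exists (fun x => match x with inl a => of_void A a | inr b => b end);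
    [|case].
split; [exact: binr | exact: binr |].
by apply/is_morphP; split=> f; rewrite /= ?ffunE ?inE.
Qed.

Lemma gcmulA o : associative (@gcmul o).
Proof.
move=> a b c; rewrite -(gclass_rep a) -(gclass_rep b) -(gclass_rep c) !gcmulE.
apply/gclassP.
pose assoc (A B C : Type) (x : A + (B + C)) : (A + B) + C :=
  match x with
  | inl a => inl (inl a) | inr (inl b) => inl (inr b) | inr (inr c) => inr c
  end.
pose assoc' (A B C : Type) (x : (A + B) + C) : A + (B + C) :=
  match x with
  | inl (inl a) => inl a | inl (inr b) => inr (inl b) | inr c => inr (inr c)
  end.
exists (@assoc _ _ _), (@assoc _ _ _); split.
- by exists (@assoc' _ _ _); [case=> [|[]] | case=> [[]|]].
- by exists (@assoc' _ _ _); [case=> [|[]] | case=> [[]|]].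
- by apply/is_morphP; split=> -[x|[x|x]]; rewrite /= ?ffunE ?inE /= ?ffunE ?inE.
Qed.

Lemma gcmulc1 o : right_id (gc1 o) (@gcmul o).
Proof. by move=> c; rewrite gcmulC gcmul1c. Qed.

Lemma nvert1 o : nvert (gc1 o) = 0%N.
Proof. by rewrite nvert_gclass card_void. Qed.

Lemma nvertM o : {morph (@nvert o) : c d / gcmul c d >-> (c + d)%N}.
Proof. by move=> c d; rewrite nvert_gclass card_sum !card_ord. Qed.

Lemma card_flags o (V F : finType) (G : ctgraph o V F) : #|F| = (3 * #|V|)%N.
Proof.
have /colored_trivalentP [_ _ _ H _] := ctvalP G.
rewrite -sum1_card (partition_big (attach G) predT) //=.
rewrite (eq_bigr (fun=> 3%N)) => [|v _]; first by rewrite sum_nat_const mulnC.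
by rewrite sum1dep_card H.
Qed.

Lemma nvert_eq0 o (c : graph_class o) : nvert c = 0%N -> c = gc1 o.
Proof.
move=> c0; have f0 : nflag c = 0%N.
  by have := card_flags (rep c); rewrite !card_ord c0.
rewrite -(gclass_rep c); apply/gclassP/iso_sym.
have bij n : n = 0%N -> bijective (of_void 'I_n).
  by move=> ->; apply: inj_card_bij; [case | rewrite card_void card_ord].
exists (of_void _), (of_void _).
by split; [exact: bij | exact: bij | apply/is_morphP; split; case].
Qed.

Lemma gcmul_eq1 o (c d : graph_class o) :
  gcmul c d = gc1 o -> c = gc1 o /\ d = gc1 o.
Proof.
move=> cd; have /eqP := nvertM c d; rewrite cd nvert1 eq_sym addn_eq0.
by case/andP=> /eqP c0 /eqP d0; split; apply: nvert_eq0.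
Qed.

HB.instance Definition _ o := Choice_isMonomialDef.Build (graph_class o)
  (@gcmulA o) (@gcmul1c o) (@gcmulc1 o) (@gcmul_eq1 o).
HB.instance Definition _ o := MonomialDef_isConomialDef.Build (graph_class o)
  (@gcmulC o).
HB.instance Definition _ o := isMeasure.Build (graph_class o) (@nvert o)
  (@nvert1 o) (@nvertM o) (@nvert_eq0 o).

(* A trivalent graph with [2n] vertices has [3 * 2n] flags. *)
Definition Gamma o (n : nat) : {fset graph_class o} :=
  [fset gclass G | G : ctgraph o 'I_(2 * n) 'I_(3 * (2 * n))]%fset.

Lemma mem_Gamma o n (c : graph_class o) :
  (c \in Gamma o n) = (nvert c == (2 * n)%N).
Proof.
apply/imfsetP/eqP => [[G _ ->]|cn]; first by rewrite nvert_gclass card_ord.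
have fn : nflag c = (3 * (2 * n))%N.
  by have := card_flags (rep c); rewrite !card_ord cn.
rewrite -(gclass_rep c); move: (rep c); rewrite cn fn => G.
by exists G.
Qed.

Section Completion.
Variables (R : realType) (o : bool).
Implicit Types x y : {malg R[graph_class o]}.

Definition homog (n : nat) x := all (fun c => nvert c == (2 * n)%N) (msupp x).

Lemma homogP n x :
  reflect (forall c, x@_c != 0 -> nvert c = (2 * n)%N) (homog n x).
Proof.
apply: (iffP allP) => H c.
  by rewrite mcoeff_neq0 => /H /eqP.
by move=> cx; apply/eqP/H; rewrite mcoeff_neq0.
Qed.

Lemma homog0 n : homog n 0.
Proof. by apply/homogP => c; rewrite mcoeff0 eqxx. Qed.

Lemma homogD n x y : homog n x -> homog n y -> homog n (x + y).
Proof.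
move=> /homogP hx /homogP hy; apply/homogP => c; rewrite mcoeffD.
have [->|xc _] := eqVneq x@_c 0; last exact: hx.
by rewrite add0r; apply: hy.
Qed.

Lemma homogZ n a x : homog n x -> homog n (a *: x).
Proof.
move=> /homogP hx; apply/homogP => c; rewrite mcoeffZ mulf_eq0 negb_or.
by case/andP=> _; apply: hx.
Qed.

Lemma homog_sum n (I : Type) (r : seq I) (P : pred I)
    (E : I -> {malg R[graph_class o]}) :
  (forall i, P i -> homog n (E i)) -> homog n (\sum_(i <- r | P i) E i).
Proof.
by move=> H; elim/big_rec: _ => [|i y Pi]; [apply: homog0 | apply/homogD/H].
Qed.

Lemma homogU n c : nvert c = (2 * n)%N -> homog n (<< c >> : {malg R[_]}).
Proof.
move=> cn; apply/homogP => d; rewrite mcoeffU1.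
by have [<-|] := eqVneq c d; rewrite ?eqxx.
Qed.

Lemma homogM m n x y : homog m x -> homog n y -> homog (m + n) (x * y).
Proof.
move=> /homogP hx /homogP hy; rewrite malgME big_seq_cond.
apply: homog_sum => c /andP [cx _]; rewrite big_seq_cond.
apply: homog_sum => d /andP [dy _].
apply/homogP => e; rewrite mcoeffU.
have [<- _|] := eqVneq (mmul c d) e; last by rewrite mulr0n eqxx.
by rewrite nvertM hx ?hy ?mcoeff_neq0 // mulnDr.
Qed.

Record completion := Completion {
  component :> nat -> {malg R[graph_class o]};
  componentP : forall n, homog n (component n) }.

Lemma completion_eq (f g : completion) : (forall n, f n = g n) -> f = g.
Proof.
case: f g => [f fP] [g gP] /= /funext fg; rewrite {}fg in fP *.
by congr Completion; apply: Prop_irrelevance.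
Qed.

Lemma compl_one_proof n : homog n (if n == 0%N then 1 else 0).
Proof.
case: eqP => [->|_]; last exact: homog0.
by apply: homogU; rewrite nvert1.
Qed.
Definition compl_one := Completion compl_one_proof.

Lemma compl_mul_proof (f g : completion) n :
  homog n (\sum_(i < n.+1) f i * g (n - i)%N).
Proof.
apply: homog_sum => i _.
by rewrite -[X in homog X _](subnKC (leq_ord i)); apply/homogM/componentP/componentP.
Qed.
Definition compl_mul f g := Completion (compl_mul_proof f g).

Definition compl_pow f k := iter k (compl_mul f) compl_one.

Lemma compl_pow_eq0 (f : completion) k n : f 0%N = 0 -> (n < k)%N -> compl_pow f k n = 0.
Proof.
move=> f0; elim: k n => // k IHk n nk; apply: big1 => -[[|i] /= ilt] _.
  by rewrite f0 mul0r.
rewrite IHk ?mulr0 // -ltnS; apply: leq_trans nk.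
by rewrite ltnS ltn_subrL /=; case: (n) ilt.
Qed.

(* The exponential of a series without constant term: by [compl_pow_eq0] the  *)
(* omitted powers [k > n] do not contribute to the component of degree [n].    *)
Lemma compl_exp_proof (f : completion) n :
  homog n (\sum_(k < n.+1) (k`!%:R)^-1 *: compl_pow f k n).
Proof. by apply: homog_sum => k _; apply/homogZ/componentP. Qed.
Definition compl_exp f := Completion (compl_exp_proof f).
End Completion.

Record matching (T : finType) := Matching {
  mate :> {ffun T -> T};
  mateP : [forall x, (mate (mate x) == x) && (mate x != x)] }.

HB.instance Definition _ T := [isSub for @mate T].
HB.instance Definition _ T := [Finite of matching T by <:].

Definition open_flag (V F : finType) (G : flag_graph V F) : finType :=
  {f : F | theta G f == f}.

Section Glue.
Variables (V F : finType) (G : ctgraph true V F) (s : matching (open_flag G)).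

Definition glue_theta (f : F) : F :=
  if insub f is Some x then val (s x) else theta G f.

Definition glue_graph : flag_graph V F :=
  FlagGraph (finfun glue_theta) (attach G) (red G).

Lemma glue_proof : colored_trivalent false glue_graph.
Proof.
have /colored_trivalentP [H1 H2 H3 H4 H5] := ctvalP G.
have sP x : s (s x) = x /\ s x != x.
  by have /andP [/eqP] := forallP (mateP s) x.
have openN (x : open_flag G) : val x \notin red G.
  by case: (H2 (val x)) => //; apply/eqP/(valP x).
apply/colored_trivalentP; split => //= f; rewrite !ffunE.
- rewrite {2}/glue_theta; case: insubP => [x _ <-|fN]; rewrite /glue_theta.
    by rewrite valK (sP x).1.
  by rewrite insubF ?H1 // eq_sym; apply/negbTE.
- rewrite /glue_theta; case: insubP => [x _ <- /val_inj sx|fN /eqP ff].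
    by have := (sP x).2; rewrite sx eqxx.
  by rewrite ff in fN.
- rewrite /glue_theta; case: insubP => [x _ <-|_]; last exact: H3.
  by rewrite !(negbTE (openN _)).
Qed.

Definition glue : ctgraph false V F := CTGraph glue_proof.
End Glue.

Section Closure.
Variable R : realType.

Definition closure_class (c : graph_class true) : {malg R[graph_class false]} :=
  \sum_(s : matching (open_flag (rep c))) << gclass (glue s) >>.

Definition closure (x : {malg R[graph_class true]}) :
    {malg R[graph_class false]} :=
  \sum_(c <- msupp x) x@_c *: closure_class c.

Lemma compl_closure_proof (f : completion R true) n : homog n (closure (f n)).
Proof.
rewrite /closure big_seq_cond; apply: homog_sum => c /andP [cf _].
apply/homogZ/homog_sum => s _; apply: homogU.
rewrite nvert_gclass card_ord; have /homogP := componentP f n.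
by apply; rewrite mcoeff_neq0.
Qed.
Definition compl_closure f := Completion (compl_closure_proof f).
End Closure.

(* The vertices of [C_r] in cyclic order are (0,false), (0,true), (1,false),  *)
(* (1,true), ... and end with (r-1,true).  The three flags at a vertex [v]    *)
(* are the red flag (v,None), the black flag (v,Some false) of the cycle and  *)
(* the open black flag (v,Some true).  Red edges join (k,false) to (k,true),  *)
(* black edges of the cycle join (k,true) to (k+1 mod r,false).               *)
Section Cycle.
Variable r : nat.
Let V : finType := ('I_r * bool)%type.
Let F : finType := (V * option bool)%type.

Definition cycle_theta (f : F) : F :=
  match f with
  | ((k, b), None) => ((k, ~~ b), None)
  | ((k, true), Some false) => ((ordS k, false), Some false)
  | ((k, false), Some false) => ((ord_pred k, true), Some false)
  | (v, Some true) => (v, Some true)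
  end.

Definition cycle_graph : flag_graph V F :=
  FlagGraph (finfun cycle_theta) [ffun f : F => f.1] [set f : F | f.2 == None].

Lemma cycle_proof : colored_trivalent true cycle_graph.
Proof.
apply/colored_trivalentP; split => /=.
- by case=> [[k []] [[]|]]; rewrite !ffunE /= ?ordSK ?ord_predK.
- by case=> [[k []] [[]|]]; rewrite !ffunE ?inE.
- by case=> [[k []] [[]|]]; rewrite !ffunE ?inE.
- move=> v; have -> : [set f : F | finfun (fun f : F => f.1) f == v] =
      setX [set v] [set: option bool].
    by apply/setP => -[w l]; rewrite !inE ffunE andbT.
  by rewrite cardsX cards1 cardsT card_option card_bool.
- move=> v; rewrite -(cards1 ((v, None) : F)).
  congr #|pred_of_set _|; apply/setP => -[w l].
  by rewrite !inE ffunE /= xpair_eqE andbC.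
Qed.

Definition alternating_cycle : ctgraph true V F := CTGraph cycle_proof.
End Cycle.

Section MomentPolynomials.
Variable R : realType.

Definition cycle_component (r : nat) : {malg R[graph_class true]} :=
  if r == 0%N then 0
  else ((-1) ^+ r / (2 * r)%:R) *: << gclass (alternating_cycle r) >>.

Lemma cycle_series_proof r : homog r (cycle_component r).
Proof.
rewrite /cycle_component; case: eqP => [_|_]; first exact: homog0.
apply/homogZ/homogU.
by rewrite nvert_gclass card_prod card_ord card_bool mulnC.
Qed.

Definition cycle_series : completion R true := Completion cycle_series_proof.

Definition Psi : completion R false := compl_closure (compl_exp cycle_series).

End MomentPolynomials.

Section Invariants.
Variables (V F : finType) (G : flag_graph V F).

Definition adj (u v : V) :=
  [exists f, (attach G f == u) && (attach G (theta G f) == v)].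

Definition black_adj (u v : V) :=
  [exists f, [&& f \notin red G, attach G f == u & attach G (theta G f) == v]].

Definition connected := (0 < #|V|)%N && [forall u, forall v, connect adj u v].

(* The connected components of the black subgraph are cycles; the length of   *)
(* a cycle is the number of its vertices.                                     *)
Definition black_cycles : {set {set V}} :=
  [set [set v | connect black_adj u v] | u : V].

Definition black_even := [forall C : {set V} in black_cycles, ~~ odd #|C|].

Definition long_cycles := #|[set C : {set V} in black_cycles | (2 < #|C|)%N]|.

Definition Aut_bar : {set {perm V}} :=
  [set p : {perm V} | [exists q : {perm F}, is_morph G G p q]].
End Invariants.

Section LogSeries.
Variable R : realType.

Definition log_component (n : nat) : {malg R[graph_class false]} :=
  \sum_(c <- Gamma false n | connected (rep c) && black_even (rep c))
    ((-1) ^+ (nvert c)./2 * (2 ^+ long_cycles (rep c) / #|Aut_bar (rep c)|%:R))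
      *: << c >>.

Lemma log_series_proof n : homog n (log_component n).
Proof.
rewrite /log_component big_seq_cond; apply: homog_sum => c /andP [cn _].
by apply/homogZ/homogU/eqP; rewrite -mem_Gamma.
Qed.

Definition log_series : completion R false := Completion log_series_proof.

End LogSeries.

(* Main.v *)
From HB Require Import structures.
Require Import Defs.
From mathcomp Require Import all_boot all_order all_algebra reals.
From mathcomp Require Import finmap fingroup perm ring.
From mathcomp.multinomials Require Import monalg.

(** Both sides are exponential generating functions of labelled structures.

    Forget the flags and keep only the vertex set [V]: a trivalent graph whose
    black edges are coloured alternately by two colours is a triple of fixed
    point free involutions of [V], one for the red edges and one for each black
    colour; a disjoint union of alternating cycles with open flags is a pair of
    such involutions.  Such a tuple is called an edge system below.

    A pair of involutions that acts transitively on [2r] points is one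
    alternating cycle, and it has [2r] automorphisms, so that [C_r / (2r)] is
    the sum over all transitive pairs on [2r] labels divided by [(2r)!].  The
    exponential formula ([exponential_formula]) says that the exponential of a
    normalized sum over connected edge systems is the normalized sum over all
    edge systems.  It comes from splitting off the component of a chosen vertex
    ([sys_sum_component]), which is the recursion that characterizes an
    exponential ([compl_exp_unique]).  Hence the argument of the closure is the
    sum over all pairs of involutions, weighted by [(-1)^n / (2n)!].

    Closing the open flags adds the third involution ([closure_sys_series]), so
    [Psi] is the sum over all triples with the same weight, and by the
    exponential formula, read in the other direction, its logarithm is the sum
    over the transitive triples.

    It remains to collect the triples with a given connected graph [gamma].
    Counting pairs of a triple and a bijection of its labels with the vertices
    of [gamma] in two ways ([card_graph_systems]) shows that their number is
    [(2n)!] times the number of alternating colourings of the black cycles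
    divided by the order of [Aut_bar gamma].  A colouring exists if and only if
    all black cycles are even ([colourings_nonempty]), and the others arise
    from it by exchanging the colours along a set of black cycles, which changes
    the involutions only on the cycles of length greater than two; so there are
    [2 ^ long_cycles gamma] of them ([card_colourings]). *)

Set Implicit Arguments.
Unset Strict Implicit.
Unset Printing Implicit Defensive.

Import GRing.Theory Num.Theory.
Local Open Scope ring_scope.

(** * Exponentials of graded series *)
Section ConvolutionPowers.
Variable A : comNzRingType.

(** The powers of a sequence under convolution are the powers of a truncated
    polynomial, which makes the derivative of polynomials available. *)
Lemma coef_poly_pow (u : nat -> A) (w : nat -> nat -> A) N k n :
    (forall m, w 0%N m = (m == 0%N)%:R) ->
    (forall j m, w j.+1 m = \sum_(i < m.+1) u i * w j (m - i)%N) ->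
  (n <= N)%N -> ((\poly_(i < N.+1) u i) ^+ k)`_n = w k n.
Proof.
move=> w0 wS; elim: k n => [|k IHk] n nN; first by rewrite expr0 coef1 w0.
rewrite exprS coefM wS; apply: eq_bigr => i _.
have iN : (i < N.+1)%N by apply: leq_trans (ltn_ord i) _.
by rewrite coef_poly iN IHk // (leq_trans (leq_subr _ _)).
Qed.

(** The Leibniz rule for the derivation that multiplies the term of degree [n]
    by [n]: it comes from the derivative of a power of a polynomial. *)
Lemma euler_conv_pow (u : nat -> A) (w : nat -> nat -> A) k n :
    (forall m, w 0%N m = (m == 0%N)%:R) ->
    (forall j m, w j.+1 m = \sum_(i < m.+1) u i * w j (m - i)%N) ->
  w k.+1 n *+ n = (\sum_(j < n.+1) (u j *+ j) * w k (n - j)%N) *+ k.+1.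
Proof.
move=> w0 wS.
case: n => [|n]; first by rewrite mulr0n big_ord1 mulr0n mul0r mul0rn.
rewrite -(coef_poly_pow k.+1 w0 wS (leqnn n.+1)) -coef_deriv deriv_exp.
rewrite coefMn coefM [in RHS]big_ord_recl mulr0n mul0r add0r.
congr (_ *+ _); apply: eq_bigr => i _.
rewrite coef_deriv coef_poly ltnS ltn_ord lift0.
by rewrite subSS (coef_poly_pow k w0 wS) // (leq_trans (leq_subr _ _)).
Qed.

End ConvolutionPowers.
Section Exponential.
Variables (R : realType) (o : bool).
Implicit Types f g : completion R o.

Lemma euler_compl_pow f k n :
  (compl_pow f k.+1 n) *+ n =
  (\sum_(j < n.+1) (f j *+ j) * compl_pow f k (n - j)%N) *+ k.+1.
Proof.
apply: (euler_conv_pow (u := f) (w := fun j => compl_pow f j)) => //.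
by move=> m; rewrite /= ; case: (m == 0)%N.
Qed.

(** Making the range of summation independent of the degree allows the sums
    over powers and over degrees to be exchanged. *)
Lemma compl_exp_widen g n N : g 0%N = 0 -> (n <= N)%N ->
  compl_exp g n = \sum_(k < N.+1) (k`!%:R)^-1 *: compl_pow g k n.
Proof.
move=> g0 nN.
rewrite /= -!(big_mkord xpredT (fun k => (k`!%:R)^-1 *: compl_pow g k n)).
rewrite [RHS](@big_cat_nat _ _ _ n.+1) //= [X in _ = _ + X]big_nat_cond.
rewrite [X in _ = _ + X]big1 ?addr0 // => k /andP[/andP[nk _] _].
by rewrite compl_pow_eq0 ?scaler0.
Qed.

(** This is [E' = g' E] for the Euler derivation and [E] the exponential
    of [g]. *)
Lemma euler_compl_exp g n : g 0%N = 0 ->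
  compl_exp g n *+ n = \sum_(j < n.+1) (g j *+ j) * compl_exp g (n - j)%N.
Proof.
move=> g0; case: n => [|n].
  by rewrite big_ord1 !mulr0n mul0r.
have g0n : compl_pow g 0 n.+1 = 0 by [].
rewrite (compl_exp_widen g0 (leqnn _)) big_ord_recl g0n scaler0 add0r -sumrMnl.
transitivity (\sum_(k < n.+1) \sum_(j < n.+2)
    (g j *+ j) * ((k`!%:R)^-1 *: compl_pow g k (n.+1 - j)%N)).
  apply: eq_bigr => k _; rewrite lift0 scalerMnr euler_compl_pow.
  rewrite -scalerMnr scalerMnl factS natrM invfM -mulr_natr mulrAC mulVf.
    by rewrite mul1r scaler_sumr; apply: eq_bigr => j _; rewrite scalerAr.
  by rewrite pnatr_eq0.
rewrite exchange_big; apply: eq_bigr => j _ /=; rewrite -mulr_sumr.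
have [->|j0] := posnP j; first by rewrite mulr0n !mul0r.
by rewrite -(compl_exp_widen g0) // leq_subLR (leq_add j0 (leqnn n)).
Qed.

(** The Euler recursion determines a series from its constant term, because
    the coefficient field has characteristic zero. *)
Lemma compl_exp_unique f g : g 0%N = 0 -> f 0%N = 1 ->
    (forall n, f n.+1 *+ n.+1 =
       \sum_(j < n.+1) (g j.+1 *+ j.+1) * f (n - j)%N) ->
  f = compl_exp g.
Proof.
move=> g0 f0 fE; apply: completion_eq => n.
elim/ltn_ind: n => -[_|n IHn].
  by rewrite f0 /= big_ord1 invr1 scale1r.
apply: (@scalerI _ _ (n.+1%:R : R)); first by rewrite pnatr_eq0.
rewrite !scaler_nat fE (euler_compl_exp _ g0) [RHS]big_ord_recl mulr0n mul0r add0r.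
apply: eq_bigr => j _; rewrite lift0 subSS; congr (_ * _); apply: IHn.
by rewrite ltnS leq_subr.
Qed.

End Exponential.

(** * Edge systems *)
Section EdgeSystems.
Variables (o : bool) (V : finType).

(** The index [i] of an involution names the flag that it pairs at each vertex,
    with the labels of the flags of an alternating cycle: [None] is red,
    [Some false] is black and [Some true] is the black flag that is open when
    [o] is true.  Encoding the missing third involution of the open case as the
    identity treats pairs ([o = true]) and triples ([o = false]) together. *)
Definition edge_system_axiom (s : {ffun option bool -> {ffun V -> V}}) :=
  [forall i, forall x,
    (s i (s i x) == x) && ((s i x == x) == o && (i == Some true))].

Record edge_system := EdgeSystem {
  mates :> {ffun option bool -> {ffun V -> V}};
  matesP : edge_system_axiom mates }.

HB.instance Definition _ := [isSub for @mates].
HB.instance Definition _ := [Finite of edge_system by <:].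

Implicit Types s t : edge_system.

Lemma matesK s i : involutive (s i).
Proof. by move=> x; have /forallP/(_ i)/forallP/(_ x)/andP[/eqP] := matesP s. Qed.

Lemma mates_fix s i x : (s i x == x) = o && (i == Some true).
Proof. by have /forallP /(_ i) /forallP /(_ x) /andP[_ /eqP] := matesP s. Qed.

Lemma mates_neq s i x : ~~ (o && (i == Some true)) -> s i x != x.
Proof. by rewrite mates_fix. Qed.

Lemma edge_system_eq s t : (forall i x, s i x = t i x) -> s = t.
Proof. by move=> st; apply/val_inj/ffunP => i; apply/ffunP => x; apply: st. Qed.

Section Build.
Variable f : option bool -> V -> V.
Hypothesis fK : forall i, involutive (f i).
Hypothesis f_fix : forall i x, (f i x == x) = o && (i == Some true).

Lemma build_system_proof : edge_system_axiom [ffun i => [ffun x => f i x]].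
Proof. by apply/forallP => i; apply/forallP => x; rewrite !ffunE fK f_fix !eqxx. Qed.

Definition build_system := EdgeSystem build_system_proof.

Lemma build_systemE i x : build_system i x = f i x.
Proof. by rewrite /= !ffunE. Qed.
End Build.

Definition step s x y := [exists i, s i x == y].

Lemma step_mates s i x : step s x (s i x).
Proof. by apply/existsP; exists i. Qed.

Lemma step_sym s : connect_sym (step s).
Proof.
apply: sym_connect_sym => x y.
by apply/existsP/existsP => -[i /eqP <-]; exists i; rewrite matesK.
Qed.

Lemma connect_step_ind s (P : pred V) x y :
  P x -> (forall i z, P z -> P (s i z)) -> connect (step s) x y -> P y.
Proof.
move=> Px PS /connectP[p xp ->]; elim: p x Px xp => //= z p IHp x Px.
by case/andP=> /existsP[i /eqP <-]; apply/IHp/PS.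
Qed.

Definition sys_connected s :=
  (0 < #|V|)%N && [forall x, forall y, connect (step s) x y].

Lemma sys_connectedP s x :
  reflect (forall y, connect (step s) x y) (sys_connected s).
Proof.
apply: (iffP andP) => [[_ /forallP/(_ x)/forallP] //|sx].
split; first by apply/card_gt0P; exists x.
apply/forallP => y; apply/forallP => z.
by apply: connect_trans (sx z); rewrite step_sym.
Qed.

Definition system_graph s : flag_graph V (V * option bool)%type :=
  FlagGraph [ffun f => (s f.2 f.1, f.2)] [ffun f => f.1] [set f | f.2 == None].

Lemma system_graph_proof s : colored_trivalent o (system_graph s).
Proof.
apply/colored_trivalentP; split => /=.
- by case=> x i; rewrite !ffunE /= matesK.
- case=> x i; rewrite ffunE inE /= => -[/eqP]; rewrite mates_fix.
  by case/andP=> -> /eqP ->.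
- by case=> x i; rewrite !inE ffunE.
- move=> v; have -> : [set f | [ffun f : V * option bool => f.1] f == v] =
      setX [set v] [set: option bool].
    by apply/setP => -[w l]; rewrite !inE ffunE andbT.
  by rewrite cardsX cards1 cardsT card_option card_bool.
- move=> v; rewrite -(cards1 (v, None : option bool)).
  congr #|pred_of_set _|; apply/setP => -[w l].
  by rewrite !inE ffunE /= xpair_eqE andbC.
Qed.

Definition system_ctgraph s := CTGraph (system_graph_proof s).
Definition sys_class s := gclass (system_ctgraph s).

Lemma nvert_sys_class s : nvert (sys_class s) = #|V|.
Proof. exact: nvert_gclass. Qed.

End EdgeSystems.

Section SystemMaps.
Variable o : bool.

(** A bijection of vertices extends to flags, because the flag labelled [i] at
    a vertex is determined by the vertex and [i]. *)
Lemma sys_class_map (V W : finType) (h : V -> W)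
    (s : edge_system o V) (t : edge_system o W) :
  bijective h -> (forall i x, h (s i x) = t i (h x)) -> sys_class s = sys_class t.
Proof.
move=> [g hK gK] ht; apply/gclassP.
exists h, (fun f => (h f.1, f.2)); split; first by exists g.
  by exists (fun f => (g f.1, f.2)) => -[x i] /=; rewrite ?hK ?gK.
by apply/is_morphP; split=> -[x i]; rewrite /= ?ffunE ?inE //= ht.
Qed.

Section Map.
Variables (V W : finType) (h : V -> W) (g : W -> V).
Hypotheses (hK : cancel h g) (gK : cancel g h).

Lemma map_systemK (s : edge_system o V) i :
  involutive (fun x => h (s i (g x))).
Proof. by move=> x; rewrite hK matesK gK. Qed.

Lemma map_system_fix (s : edge_system o V) i x :
  (h (s i (g x)) == x) = o && (i == Some true).
Proof. by rewrite -(mates_fix s i (g x)) -(inj_eq (can_inj gK)) hK. Qed.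

Definition map_system (s : edge_system o V) : edge_system o W :=
  build_system (map_systemK s) (map_system_fix s).

Lemma map_systemE s i x : map_system s i x = h (s i (g x)).
Proof. exact: build_systemE. Qed.

Lemma sys_class_map_system s : sys_class (map_system s) = sys_class s.
Proof.
apply/esym/(@sys_class_map _ _ h); first by exists g.
by move=> i x; rewrite map_systemE hK.
Qed.

Lemma map_connect s x y :
  connect (step s) x y -> connect (step (map_system s)) (h x) (h y).
Proof.
apply: (connect_step_ind (P := fun y => connect _ (h x) (h y))) => // i z xz.
by apply: connect_trans xz (connect1 _); apply/existsP; exists i; rewrite map_systemE hK.
Qed.

End Map.

Lemma map_system_can (V W : finType) (h : V -> W) (g : W -> V)
    (hK : cancel h g) (gK : cancel g h) :
  cancel (map_system hK gK) (map_system gK hK).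
Proof. by move=> s; apply: edge_system_eq => i x; rewrite !map_systemE !hK. Qed.

Lemma map_system_connected (V W : finType) (h : V -> W) (g : W -> V)
    (hK : cancel h g) (gK : cancel g h) s :
  sys_connected (map_system hK gK s) = sys_connected s.
Proof.
have VW : #|V| = #|W| by apply/(bij_eq_card (f := h)); exists g.
rewrite /sys_connected VW; congr (_ && _).
apply/forallP/forallP => st x; apply/forallP => y.
  rewrite -[x]hK -[y]hK -[s](map_system_can hK gK); apply: map_connect.
  exact: (forallP (st _)).
rewrite -[x]gK -[y]gK; apply: map_connect; exact: (forallP (st _)).
Qed.

End SystemMaps.

Section SystemSums.
Variables (R : realType) (o : bool).
Implicit Type V : finType.

Definition sys_sum V : {malg R[graph_class o]} :=
  \sum_(s : edge_system o V) << sys_class s >>.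

Definition conn_sum V : {malg R[graph_class o]} :=
  \sum_(s : edge_system o V | sys_connected s) << sys_class s >>.

Lemma bij_card V (W : finType) : #|V| = #|W| ->
  {h : V -> W & {g : W -> V | cancel h g & cancel g h}}.
Proof.
move=> VW; exists (fun x => enum_val (cast_ord VW (enum_rank x))).
exists (fun x => enum_val (cast_ord (esym VW) (enum_rank x))) => x.
  by rewrite enum_valK cast_ordK enum_rankK.
by rewrite enum_valK cast_ordKV enum_rankK.
Qed.

Lemma sys_sum_card V (W : finType) : #|V| = #|W| -> sys_sum V = sys_sum W.
Proof.
case/bij_card=> h [g hK gK]; rewrite /sys_sum.
rewrite (reindex (map_system (o := o) gK hK)).
  by apply: eq_bigr => s _; rewrite sys_class_map_system.
by exists (map_system hK gK) => s _; apply: map_system_can.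
Qed.

Lemma conn_sum_card V (W : finType) : #|V| = #|W| -> conn_sum V = conn_sum W.
Proof.
case/bij_card=> h [g hK gK]; rewrite /conn_sum.
rewrite (reindex (map_system (o := o) gK hK)).
  by apply: eq_big => s; rewrite ?map_system_connected ?sys_class_map_system.
by exists (map_system hK gK) => s _; apply: map_system_can.
Qed.

End SystemSums.

(** * Disjoint unions and components *)
Section DisjointSums.
Variables (o : bool) (V W : finType).
Variables (s : edge_system o V) (t : edge_system o W).

Definition sum_mate i (x : V + W) : V + W :=
  match x with inl a => inl (s i a) | inr b => inr (t i b) end.

Lemma sum_mateK i : involutive (sum_mate i).
Proof. by case=> x /=; rewrite matesK. Qed.

Lemma sum_mate_fix i x : (sum_mate i x == x) = o && (i == Some true).
Proof.
by case: x => x /=; rewrite ?(inj_eq inl_inj) ?(inj_eq inr_inj) mates_fix.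
Qed.

Definition sum_system : edge_system o (V + W)%type :=
  build_system sum_mateK sum_mate_fix.

Lemma sum_systemE i x : sum_system i x = sum_mate i x.
Proof. exact: build_systemE. Qed.

Lemma sys_class_sum : sys_class sum_system = gcmul (sys_class s) (sys_class t).
Proof.
rewrite gcmulE; apply/gclassP/iso_sym; exists id.
exists (fun f => match f with
  | inl (x, i) => (inl x, i) | inr (y, i) => (inr y, i) end).
split; first by exists id.
  exists (fun f => match f with
    | (inl x, i) => inl (x, i) | (inr y, i) => inr (y, i) end).
  - by case=> -[].
  - by case=> -[].
apply/is_morphP; split=> -[] [x i]; rewrite /= ?ffunE ?inE //=;
  by rewrite ?sum_systemE ?ffunE ?inE.
Qed.

End DisjointSums.

Lemma malgU_mmul (R : realType) (K : monomType) (c d : K) :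
  << mmul c d >> = << c >> * << d >> :> {malg R[K]}.
Proof. by rewrite malgME !msuppU1 !big_seq_fset1 !mcoeffUU mulr1. Qed.

Lemma malgU_gcmul (R : realType) o (c d : graph_class o) :
  << gcmul c d >> = << c >> * << d >> :> {malg R[graph_class o]}.
Proof. exact: malgU_mmul. Qed.

Section Decomposition.
Variables (o : bool) (V : finType) (x0 : V) (A : {set V}).
Hypothesis x0A : x0 \in A.

Let V1 : finType := {x : V | x \in A}.
Let V2 : finType := {x : V | x \notin A}.

Definition join_sides (u : V1 + V2) : V :=
  match u with inl x => val x | inr y => val y end.

Definition split_sides (x : V) : V1 + V2 :=
  match boolP (x \in A) with
  | AltTrue xA => inl (Sub x xA)
  | AltFalse xA => inr (Sub x xA)
  end.

Lemma join_sidesK : cancel join_sides split_sides.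
Proof.
case=> -[x xA] /=; rewrite /split_sides; case: {-}_ / boolP => xA'.
- by congr inl; apply: val_inj.
- by case/negP: (xA').
- by case/negP: (xA).
- by congr inr; apply: val_inj.
Qed.

Lemma split_sidesK : cancel split_sides join_sides.
Proof. by move=> x; rewrite /split_sides; case: {-}_ / boolP. Qed.

Definition glue_systems (st : edge_system o V1 * edge_system o V2) :=
  map_system join_sidesK split_sidesK (sum_system st.1 st.2).

Lemma glue_systemsl st (x : V1) i : glue_systems st i (val x) = val (st.1 i x).
Proof. by rewrite map_systemE -[val x]/(join_sides (inl x)) join_sidesK sum_systemE. Qed.

Lemma glue_systemsr st (y : V2) i : glue_systems st i (val y) = val (st.2 i y).
Proof. by rewrite map_systemE -[val y]/(join_sides (inr y)) join_sidesK sum_systemE. Qed.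

Lemma glue_systems_inj : injective glue_systems.
Proof.
move=> [s1 s2] [t1 t2] st; congr (_, _); apply: edge_system_eq => i x;
  apply: val_inj.
  by rewrite -(glue_systemsl (s1, s2)) st glue_systemsl.
by rewrite -(glue_systemsr (s1, s2)) st glue_systemsr.
Qed.

Lemma sys_class_glue st :
  sys_class (glue_systems st) = gcmul (sys_class st.1) (sys_class st.2).
Proof. by rewrite sys_class_map_system sys_class_sum. Qed.

Definition component_of (s : edge_system o V) :=
  [set x | connect (step s) x0 x].

(** The two sides of a glued system do not interact, so the component of a
    vertex of [A] stays in [A]; it fills [A] exactly if the part on [A] is
    connected. *)
Lemma component_glue st :
  (component_of (glue_systems st) == A) = sys_connected st.1.
Proof.
pose y0 : V1 := Sub x0 x0A.
have sub : component_of (glue_systems st) \subset A.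
  apply/subsetP => x; rewrite inE.
  apply: connect_step_ind x0A _ => i z zA.
  by rewrite -[z](SubK V1 zA) glue_systemsl; apply: (valP (st.1 i _)).
apply/eqP/(sys_connectedP _ y0) => [cA y|conn].
  pose P x := [exists z : V1, (val z == x) && connect (step st.1) y0 z].
  have Py0 : P x0 by apply/existsP; exists y0; rewrite /= eqxx connect0.
  have PS i x : P x -> P (glue_systems st i x).
    case/existsP=> z /andP[/eqP <- y0z]; apply/existsP; exists (st.1 i z).
    rewrite glue_systemsl eqxx /=.
    exact: connect_trans y0z (connect1 (step_mates _ _ _)).
  have : val y \in component_of (glue_systems st) by rewrite cA; apply: valP y.
  rewrite inE => /(connect_step_ind Py0 PS) /existsP[z /andP[/eqP]].
  by move/val_inj=> ->.
apply/eqP; rewrite eqEsubset sub; apply/subsetP => x xA.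
rewrite inE -[x](SubK V1 xA).
apply: (connect_step_ind (P := fun y : V1 =>
  connect (step (glue_systems st)) x0 (val y)) _ _ (conn (Sub x xA))).
  exact: connect0.
move=> i z x0z; apply: connect_trans x0z (connect1 _).
by rewrite -glue_systemsl step_mates.
Qed.

Lemma component_of_glue s : component_of s = A -> exists st, s = glue_systems st.
Proof.
move=> cA; have sA i x : (s i x \in A) = (x \in A).
  rewrite -cA !inE; apply/idP/idP => x0x.
    apply: connect_trans x0x _; rewrite step_sym; exact/connect1/step_mates.
  exact: connect_trans x0x (connect1 (step_mates _ _ _)).
have sA1 i (x : V1) : s i (val x) \in A by rewrite sA (valP x).
have sA2 i (x : V2) : s i (val x) \notin A by rewrite sA (valP x).
pose f1 i (x : V1) : V1 := Sub (s i (val x)) (sA1 i x).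
pose f2 i (x : V2) : V2 := Sub (s i (val x)) (sA2 i x).
have f1K i : involutive (f1 i) by move=> x; apply: val_inj; rewrite /= matesK.
have f2K i : involutive (f2 i) by move=> x; apply: val_inj; rewrite /= matesK.
have f1_fix i x : (f1 i x == x) = o && (i == Some true).
  by rewrite -val_eqE mates_fix.
have f2_fix i x : (f2 i x == x) = o && (i == Some true).
  by rewrite -val_eqE mates_fix.
exists (build_system f1K f1_fix, build_system f2K f2_fix).
apply: edge_system_eq => i x; rewrite -[x]split_sidesK.
case: (split_sides x) => y; rewrite [join_sides _]/=.
  by rewrite glue_systemsl /= !ffunE.
by rewrite glue_systemsr /= !ffunE.
Qed.

End Decomposition.

Section Recursion.
Variables (R : realType) (o : bool).
Local Notation sys_sum := (sys_sum R o).
Local Notation conn_sum := (conn_sum R o).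

(** An edge system is determined by the component [A] of [x0], a connected
    system on [A] and an arbitrary system on the complement. *)
Lemma sys_sum_component (V : finType) (x0 : V) :
  sys_sum V = \sum_(A : {set V} | x0 \in A) conn_sum 'I_#|A| * sys_sum 'I_#|~: A|.
Proof.
rewrite /sys_sum (partition_big (component_of x0) (fun A => x0 \in A)) => [|s _];
  last by rewrite inE connect0.
apply: eq_bigr => A x0A.
rewrite (@conn_sum_card R o _ {x | x \in A}); last by rewrite card_ord card_sig.
rewrite -/(sys_sum _) (@sys_sum_card R o _ {x | x \notin A}); last first.
  by rewrite card_ord card_sig; apply: eq_card => x; rewrite !inE.
rewrite /conn_sum /sys_sum mulr_suml.
under [RHS]eq_bigr do rewrite mulr_sumr.
rewrite pair_big /=.
pose D := [set st : edge_system o {x | x \in A} * edge_system o {x | x \notin A}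
  | sys_connected st.1 && true].
transitivity (\sum_(s in [set glue_systems st | st in D])
    << sys_class s >> : {malg R[graph_class o]}).
  apply: eq_bigl => s; apply/eqP/imsetP => [cA|[st + ->]].
    have [st sE] := component_of_glue cA; exists st => //.
    by rewrite inE andbT -(component_glue x0A) -sE cA.
  by rewrite inE andbT -(component_glue x0A) => /eqP.
rewrite big_imset /=; last by move=> ? ? _ _; apply: glue_systems_inj.
apply: eq_big => st; first by rewrite inE.
by rewrite sys_class_glue malgU_gcmul.
Qed.

Lemma card_sets_containing (V : finType) (x0 : V) k :
  #|[set A : {set V} | (x0 \in A) && (#|A| == k.+1)]| = 'C(#|V|.-1, k).
Proof.
have -> : #|V|.-1 = #|[set~ x0]| by rewrite cardsC1.
have subC1 (B : {set V}) : (B \subset [set~ x0]) = (x0 \notin B).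
  by rewrite subsetC sub1set inE.
rewrite -cards_draws; apply/esym.
rewrite -(card_in_imset (f := fun B => x0 |: B)); last first.
  move=> B C; rewrite !inE !subC1 => /andP[xB _] /andP[xC _] BC.
  by rewrite -(setU1K xB) BC setU1K.
congr #|pred_of_set _|; apply/setP => A; rewrite inE.
apply/imsetP/andP => [[B + ->]|[xA cA]].
  by rewrite inE subC1 => /andP[xB /eqP <-]; rewrite setU11 cardsU1 xB.
exists (A :\ x0); last by rewrite setD1K.
by rewrite inE subC1 setD11 /= -eqSS -(eqP cA) (cardsD1 x0 A) xA.
Qed.

Lemma sys_sum_rec m :
  sys_sum 'I_m.+1 =
  \sum_(k < m.+1) (conn_sum 'I_k.+1 * sys_sum 'I_(m - k)%N) *+ 'C(m, k).
Proof.
rewrite (sys_sum_component ord0).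
rewrite (partition_big (fun A : {set 'I_m.+1} => inord #|A|.-1 : 'I_m.+1) predT) //=.
apply: eq_bigr => k _.
have AP (A : {set 'I_m.+1}) :
    (ord0 \in A) && (inord #|A|.-1 == k) = (ord0 \in A) && (#|A| == k.+1).
  case: (boolP (ord0 \in A)) => //= xA.
  have A0 : (0 < #|A|)%N by apply/card_gt0P; exists ord0.
  rewrite -val_eqE /= inordK; last by rewrite prednK // -[X in (_ <= X)%N]card_ord max_card.
  by rewrite -eqSS prednK.
rewrite (eq_bigl _ _ AP) (eq_bigr (fun=> conn_sum 'I_k.+1 * sys_sum 'I_(m - k)%N)).
  by rewrite -big_set /= sumr_const card_sets_containing card_ord.
move=> A /andP[_ /eqP cA]; rewrite cA.
by have := cardsC A; rewrite cA card_ord => /(canRL (addKn _)) ->; rewrite subSS.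
Qed.

End Recursion.

(** * The exponential formula for edge systems *)
Lemma odd_card_involution (T : finType) (f : T -> T) :
  involutive f -> (forall x, f x != x) -> ~~ odd #|T|.
Proof.
move=> fK fN; have order2 x : fingraph.order f x = 2.
  transitivity #|[set x; f x]|; last by rewrite cards2 eq_sym fN.
  rewrite /fingraph.order; apply: eq_card => y; rewrite !inE; apply/idP/idP.
    case/connectP=> p; elim: p x => [x _ ->|z p IHp x] /=; first by rewrite eqxx.
    by case/andP=> /eqP <- /IHp IH /IH; rewrite fK orbC.
  by case/orP=> /eqP ->; [apply: connect0 | apply: fconnect1].
have fcl : fclosed f T by [].
rewrite -(fcard_order_set (can_inj fK) _ fcl (n := 2)).
  by rewrite oddM andbF.
by apply/subsetP => x _; rewrite inE order2.
Qed.

Lemma sum_odd_index (M : nmodType) (F : nat -> M) n :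
    (forall k, ~~ odd k -> F k = 0) ->
  \sum_(k < n.*2) F k = \sum_(j < n) F j.*2.+1.
Proof.
move=> F0; elim: n => [|n IHn]; first by rewrite !big_ord0.
by rewrite doubleS !big_ord_recr /= IHn F0 ?odd_double // addr0.
Qed.

Lemma weight_fraction (F : numFieldType) (c a b n j s t : F) :
  c != 0 -> a != 0 -> b != 0 -> n != 0 -> j != 0 ->
  s * t / (2 * n * (c * (a * b))) * c * n = s / (2 * j * a) * j * (t / b).
Proof. by move=> c0 a0 b0 n0 j0; field; rewrite c0 a0 b0 n0 j0. Qed.

Lemma scale_mulrn (F : comNzRingType) (A : algType F) (a b d : F) (x y : A) c n j :
  a *+ c *+ n = b *+ j * d ->
  (a *: (x * y *+ c)) *+ n = ((b *: x) *+ j) * (d *: y).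
Proof.
move=> E; rewrite -scalerMnr scalerMnl scalerMnl E.
by rewrite -scalerAr scalerMnl -scalerAl scalerA mulrC.
Qed.

Section ExponentialFormula.
Variables (R : realType) (o : bool).

Lemma conn_sum_odd (V : finType) : odd #|V| -> conn_sum R o V = 0.
Proof.
move=> oV; rewrite /conn_sum big1 // => s _; exfalso.
suff : ~~ odd #|V| by rewrite oV.
by apply: (odd_card_involution (matesK s None)) => x; rewrite mates_neq ?andbF.
Qed.

Lemma sys_sum_empty (V : finType) : #|V| = 0%N -> sys_sum R o V = 1.
Proof.
move=> V0; have noV (x : V) : False.
  by have := max_card (pred1 x); rewrite card1 V0.
have idK (i : option bool) : involutive (@id V) by [].
have id_fix (i : option bool) (x : V) : (id x == x) = o && (i == Some true).
  by case: (noV x).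
rewrite /sys_sum (bigD1 (build_system idK id_fix)) //= [X in _ + X]big1.
  by rewrite addr0 (nvert_eq0 (etrans (nvert_sys_class _) V0)).
move=> s /eqP[]; apply: edge_system_eq => i x; case: (noV x).
Qed.

(** The sign is that of [C_r] and is multiplicative; dividing by [(2n)!] turns
    sums over labelled systems into sums over unlabelled ones. *)
Definition weight n : R := (-1) ^+ n / (n.*2)`!%:R.

Lemma homog_sys_sum n (P : pred (edge_system o 'I_n.*2)) :
  homog n (weight n *: \sum_(s | P s) << sys_class s >> : {malg R[graph_class o]}).
Proof.
apply/homogZ/homog_sum => s _; apply: homogU.
by rewrite nvert_sys_class card_ord mul2n.
Qed.

Definition sys_series : completion R o :=
  Completion (fun n => homog_sys_sum xpredT).

Definition conn_series : completion R o :=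
  Completion (fun n => homog_sys_sum (@sys_connected o 'I_n.*2)).

Lemma sys_seriesE n : sys_series n = weight n *: sys_sum R o 'I_n.*2.
Proof. by []. Qed.

Lemma conn_seriesE n : conn_series n = weight n *: conn_sum R o 'I_n.*2.
Proof. by []. Qed.

(** The binomial coefficient counts the components of size [2j + 2] that
    contain a given one of the [2n + 2] vertices. *)
Lemma weight_bin n j : (j <= n)%N ->
  weight n.+1 *+ 'C(n.*2.+1, j.*2.+1) *+ n.+1 =
  weight j.+1 *+ j.+1 * weight (n - j)%N.
Proof.
move=> jn; have jn2 : (j.*2.+1 <= n.*2.+1)%N by rewrite ltnS leq_double.
have := bin_fact jn2; rewrite subSS -doubleB => binE.
have nE : (n.+1.*2)`! = (2 * n.+1 *
    ('C(n.*2.+1, j.*2.+1) * ((j.*2.+1)`! * ((n - j).*2)`!)))%N.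
  by rewrite binE mul2n doubleS factS.
have jE : (j.+1.*2)`! = (2 * j.+1 * (j.*2.+1)`!)%N by rewrite mul2n doubleS factS.
have signE : (-1) ^+ n.+1 = (-1) ^+ j.+1 * (-1) ^+ (n - j) :> R.
  by rewrite -exprD addSn subnKC.
rewrite /weight nE jE signE.
have c0 : (0 < 'C(n.*2.+1, j.*2.+1))%N by rewrite bin_gt0.
move: 'C(_, _) (j.*2.+1)`! ((n - j).*2)`! (fact_gt0 j.*2.+1) (fact_gt0 (n - j).*2)
  c0 {binE nE jE signE} => c a b a0 b0 c0.
rewrite -[LHS]mulr_natr -[X in X * n.+1%:R]mulr_natr -[X in _ = X * _]mulr_natr.
by rewrite !natrM; apply: weight_fraction; rewrite pnatr_eq0 -lt0n.
Qed.

(** Splitting off the component of one vertex is exactly the recursion that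
    characterizes the exponential; components of odd size do not occur, as they
    carry no fixed point free involution. *)
Theorem exponential_formula : sys_series = compl_exp conn_series.
Proof.
apply: compl_exp_unique.
- rewrite conn_seriesE /conn_sum big1 ?scaler0 // => s.
  by rewrite /sys_connected card_ord.
- rewrite sys_seriesE sys_sum_empty ?card_ord // /weight expr0 fact0 invr1.
  by rewrite mul1r scale1r.
move=> n; rewrite sys_seriesE doubleS sys_sum_rec -doubleS.
rewrite (sum_odd_index (F := fun k => (conn_sum R o 'I_k.+1 *
  sys_sum R o 'I_(n.*2.+1 - k)%N) *+ 'C(n.*2.+1, k))); last first.
  move=> k ek; rewrite conn_sum_odd ?mul0r ?mul0rn // card_ord /=.
  exact: ek.
rewrite scaler_sumr -sumrMnl; apply: eq_bigr => j _.
rewrite conn_seriesE sys_seriesE subSS -doubleS -doubleB.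
apply: scale_mulrn; apply: weight_bin.
by rewrite -ltnS.
Qed.

End ExponentialFormula.

(** * Two fixed point free involutions *)
Section Dihedral.
Variables (T : finType) (a b : T -> T).
Hypotheses (aK : involutive a) (bK : involutive b).
Hypotheses (aN : forall x, a x != x) (bN : forall x, b x != x).

Definition rot x := a (b x).

Lemma rot_inj : injective rot.
Proof. exact: inj_comp (can_inj aK) (can_inj bK). Qed.

Lemma rotV x : rot (b (a x)) = x.
Proof. by rewrite /rot bK aK. Qed.

(** In the dihedral group generated by [a] and [b], every reflection is
    conjugate to [a] or to [b] and hence has no fixed point either. *)
Lemma reflection_nofix k x : b (iter k rot x) != x.
Proof.
elim/ltn_ind: k x => -[_ x|[_ x|k IHk x]]; first exact: bN.
  by rewrite /= (can2_eq bK bK); apply: aN.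
apply: contraNneq (IHk k (ltnW (leqnn _)) (rot x)) => E.
apply/eqP; move: E; rewrite iterS iterSr => /(canRL bK) E.
by apply: (can_inj aK); rewrite [RHS]aK; apply: E.
Qed.

(** Therefore an orbit of the dihedral group is the disjoint union of two orbits
    of the rotation, which [b] exchanges. *)
Lemma rot_orbit_reflection x : ~~ fconnect rot x (b x).
Proof.
apply/negP => /iter_findex E; have := reflection_nofix (findex rot x (b x)) x.
by rewrite E bK eqxx.
Qed.

Definition rot_orbit x := [set y | fconnect rot x y].

Lemma rot_orbit_disjoint x : [disjoint rot_orbit x & b @: rot_orbit x].
Proof.
rewrite -setI_eq0; apply/eqP/setP => y; rewrite !inE; apply/andP=> -[xy].
case/imsetP=> z; rewrite inE => xz yE; rewrite yE in xy.
have /negP[] := rot_orbit_reflection z.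
by apply: connect_trans xy; rewrite fconnect_sym //; apply: rot_inj.
Qed.

Lemma rot_orbit_a x y :
  (a y \in rot_orbit x :|: b @: rot_orbit x) =
  (y \in rot_orbit x :|: b @: rot_orbit x).
Proof.
suff H z : z \in rot_orbit x :|: b @: rot_orbit x ->
    a z \in rot_orbit x :|: b @: rot_orbit x.
  by apply/idP/idP => [/H|/H //]; rewrite aK.
rewrite inE => /orP[|/imsetP[w + ->]]; rewrite ?inE => xz.
  apply/orP; right; apply/imsetP; exists (b (a z)); last by rewrite bK.
  by rewrite inE (same_fconnect1_r rot_inj) rotV.
by rewrite -[a (b w)]/(rot w) -(same_fconnect1_r rot_inj) xz.
Qed.

Lemma rot_orbit_b x y :
  (b y \in rot_orbit x :|: b @: rot_orbit x) =
  (y \in rot_orbit x :|: b @: rot_orbit x).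
Proof.
have H z : (b z \in b @: rot_orbit x) = (z \in rot_orbit x).
  by apply: mem_imset; apply: can_inj bK.
by rewrite !in_setU H -(H (b y)) bK orbC.
Qed.

Lemma card_rot_orbit x : #|rot_orbit x| = fingraph.order rot x.
Proof. by rewrite /fingraph.order; apply: eq_card => y; rewrite inE. Qed.

End Dihedral.

(** * Alternating cycles *)
Section CycleSystem.
Variable r : nat.
Local Notation V := ('I_r * bool)%type.

Definition cycle_mate (i : option bool) (x : V) : V :=
  match i, x with
  | None, (k, c) => (k, ~~ c)
  | Some false, (k, true) => (ordS k, false)
  | Some false, (k, false) => (ord_pred k, true)
  | Some true, _ => x
  end.

Lemma cycle_mateK i : involutive (cycle_mate i).
Proof. by case: i => [[]|] [k []] //=; rewrite ?ordSK ?ord_predK. Qed.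

Lemma cycle_mate_fix i x : (cycle_mate i x == x) = true && (i == Some true).
Proof.
by case: i x => [[]|] [k []]; rewrite /= ?eqxx // xpair_eqE andbF.
Qed.

Definition cycle_system : edge_system true V :=
  build_system cycle_mateK cycle_mate_fix.

Lemma cycle_systemE i x : cycle_system i x = cycle_mate i x.
Proof. exact: build_systemE. Qed.

Lemma sys_class_cycle : sys_class cycle_system = gclass (alternating_cycle r).
Proof.
apply/gclassP; exists id, id; split; [by exists id | by exists id|].
apply/is_morphP; split=> -[[k c] i]; rewrite /= ?ffunE ?inE //=.
by case: i c => [[]|] [].
Qed.

Lemma cycle_connected (k0 : 'I_r) x :
  k0 = 0%N :> nat -> connect (step cycle_system) (k0, false) x.
Proof.
move=> k00; have kfalse m (mr : (m < r)%N) :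
    connect (step cycle_system) (k0, false) (Ordinal mr, false).
  elim: m mr => [|m IHm] mr.
    by rewrite (_ : Ordinal mr = k0) ?connect0 //; apply: val_inj.
  apply: connect_trans (IHm (ltnW mr)) _.
  apply: (connect_trans (connect1 (step_mates cycle_system None _))).
  rewrite cycle_systemE /=.
  suff -> : Ordinal mr = ordS (Ordinal (ltnW mr)).
    apply: connect1; apply/existsP; exists (Some false).
    by rewrite cycle_systemE.
  by apply: val_inj; rewrite /= modn_small.
case: x => -[k kr] []; last exact: kfalse.
apply: connect_trans (kfalse k kr) _; apply: connect1.
by apply/existsP; exists None; rewrite cycle_systemE.
Qed.

Lemma cycle_system_connected : (0 < r)%N -> sys_connected cycle_system.
Proof.
by move=> r0; apply/(sys_connectedP _ (Ordinal r0, false)) => x; apply: cycle_connected.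
Qed.

Section Parametrize.
Variables (s : edge_system true V) (x0 : V).
Hypothesis s_conn : sys_connected s.

Let a := s (Some false).
Let b := s None.

Let aK : involutive a. Proof. exact: matesK. Qed.
Let bK : involutive b. Proof. exact: matesK. Qed.
Let aN x : a x != x. Proof. exact: mates_neq. Qed.
Let bN x : b x != x. Proof. exact: mates_neq. Qed.

(** The rotation orbit of [x0] and its image under [b] are disjoint and cover
    the [2r] points, as their union is stable and [s] is connected. *)
Lemma order_rot : fingraph.order (rot a b) x0 = r.
Proof.
pose U := rot_orbit a b x0 :|: b @: rot_orbit a b x0.
have UT : U = setT.
  apply/setP => x; rewrite [RHS]inE.
  apply: (connect_step_ind (s := s) (P := fun x => x \in U)
    _ _ (elimT (sys_connectedP s x0) s_conn x)).
    by rewrite !inE connect0.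
  move=> [[]|] z zU.
  - by have /eqP -> : s (Some true) z == z by rewrite mates_fix.
  - by rewrite -[s _ z]/(a z) /U (rot_orbit_a aK bK).
  - by rewrite -[s _ z]/(b z) /U (rot_orbit_b a bK).
have := cardsT V; rewrite -UT cardsU disjoint_setI0 ?rot_orbit_disjoint //.
rewrite cards0 subn0 card_imset; last exact: can_inj bK.
rewrite card_rot_orbit card_prod card_ord card_bool addnn -mul2n mulnC.
by move/eqP; rewrite eqn_pmul2r // => /eqP.
Qed.

(** Walking around the cycle from [x0]: this identifies the standard cycle with
    the connected system [s]. *)
Definition cycle_param (y : V) : V :=
  if y.2 then b (iter y.1 (rot a b) x0) else iter y.1 (rot a b) x0.

Lemma cycle_param_inj : injective cycle_param.
Proof.
have iter_inj (k l : 'I_r) :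
    iter k (rot a b) x0 = iter l (rot a b) x0 -> k = l.
  move=> E; apply: val_inj; rewrite /= -(@findex_iter _ (rot a b) x0 k).
    by rewrite E findex_iter // order_rot.
  by rewrite order_rot.
have cross (k l : 'I_r) :
    b (iter k (rot a b) x0) <> iter l (rot a b) x0.
  move=> E; have /negP[] := rot_orbit_reflection aK bK aN bN (iter k (rot a b) x0).
  rewrite E; apply: (connect_trans (y := x0)); last exact: fconnect_iter.
  by rewrite (fconnect_sym (rot_inj aK bK)) fconnect_iter.
move=> [k []] [l []]; rewrite /cycle_param /=.
- by move/(can_inj bK)/iter_inj ->.
- by move/cross.
- by move/esym/cross.
- by move/iter_inj ->.
Qed.

Lemma cycle_param_mates i y : cycle_param (cycle_mate i y) = s i (cycle_param y).
Proof.
have succ k : cycle_param (ordS k, false) = a (cycle_param (k, true)).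
  rewrite /cycle_param /= -[RHS]/(iter k.+1 (rot a b) x0).
  have [kr|] := ltnP k.+1 r; first by rewrite modn_small.
  rewrite leq_eqVlt ltnS leqNgt ltn_ord orbF => /eqP kr.
  rewrite -kr modnn; have := iter_order (rot_inj aK bK) x0.
  by rewrite order_rot => ->.
case: i y => [[]|] [k c] /=.
- by apply/esym/eqP; rewrite mates_fix.
- case: c; first exact: succ.
  by rewrite -[in RHS](ord_predK k) succ [RHS]aK.
- by case: c; rewrite /cycle_param //= [RHS]bK.
Qed.

End Parametrize.

Definition permute_system (p : {perm V}) :=
  map_system (permK p) (permKV p) cycle_system.

Lemma permute_systemP (p : {perm V}) (s : edge_system true V) :
  reflect (forall i x, p (cycle_system i x) = s i (p x)) (permute_system p == s).
Proof.
apply: (iffP eqP) => [<- i x|ps]; first by rewrite map_systemE permK.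
by apply: edge_system_eq => i x; rewrite map_systemE ps permKV.
Qed.

(** An isomorphism from the standard cycle is determined by the image of one
    vertex, which is arbitrary; so a connected system has [2r] of them. *)
Lemma card_cycle_params (s : edge_system true V) : (0 < r)%N -> sys_connected s ->
  #|[set p | permute_system p == s]| = (2 * r)%N.
Proof.
move=> r0 s_conn; pose x0 : V := (Ordinal r0, false).
rewrite -(card_in_imset (f := fun p : {perm V} => p x0)); last first.
  move=> p q; rewrite !inE => /permute_systemP ps /permute_systemP qs pq0.
  apply/permP => x; apply/eqP.
  apply: (connect_step_ind (P := fun x => p x == q x) _ _
    (cycle_connected x (k0 := Ordinal r0) erefl)); first exact/eqP.
  by move=> i z /eqP pqz; rewrite ps qs pqz.
transitivity #|[set: V]|; last first.
  by rewrite cardsT card_prod card_ord card_bool mulnC.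
congr #|pred_of_set _|; apply/setP => y; rewrite [RHS]inE; apply/imsetP.
exists (perm (cycle_param_inj (x0 := y) s_conn)); last by rewrite permE.
rewrite inE; apply/permute_systemP => i x.
by rewrite !permE cycle_systemE cycle_param_mates.
Qed.

End CycleSystem.

Lemma card_perm_type (T : finType) : #|{perm T}| = (#|T|)`!.
Proof.
rewrite -[#|T|]cardsT -card_perm; apply: eq_card => p; rewrite !inE.
by apply/esym/subsetP => x _; rewrite inE.
Qed.

Lemma scale_fact_div (F : numFieldType) (M : lmodType F) (x y : M) (c : F) m :
  (0 < m)%N -> x *+ m = y *+ m`! -> (c / m`!%:R) *: x = (c / m%:R) *: y.
Proof.
move=> m0 E; have mN : m%:R != 0 :> F by rewrite pnatr_eq0 -lt0n.
have fN : m`!%:R != 0 :> F by rewrite pnatr_eq0 -lt0n fact_gt0.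
have -> : x = (m%:R^-1 * m`!%:R) *: y.
  by rewrite -scalerA scaler_nat -E -scaler_nat scalerA mulVf // scale1r.
by rewrite scalerA [_^-1 * _]mulrC mulrA divfK.
Qed.

Section CycleSeries.
Variable R : realType.

(** Both sides are the sum over all [(2r)!] relabellings of the standard
    cycle. *)
Lemma conn_sum_cycle r : (0 < r)%N ->
  conn_sum R true ('I_r * bool)%type *+ (2 * r) =
  << gclass (alternating_cycle r) >> *+ (2 * r)`!.
Proof.
move=> r0; pose V : finType := ('I_r * bool)%type.
have permV : #|{perm V}| = (2 * r)`!.
  by rewrite card_perm_type card_prod card_ord card_bool mulnC.
rewrite -permV -sumr_const -sys_class_cycle.
rewrite (partition_big (@permute_system r) (@sys_connected true V)) /=; last first.
  by move=> p _; rewrite map_system_connected cycle_system_connected.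
rewrite /conn_sum -sumrMnl; apply: eq_bigr => s s_conn.
rewrite -(card_cycle_params r0 s_conn) -sumr_const.
apply: eq_big => [p|p]; first by rewrite inE.
by rewrite inE => /eqP <-; rewrite sys_class_map_system.
Qed.

Lemma conn_series_cycle : conn_series R true = cycle_series R.
Proof.
apply: completion_eq => r; rewrite conn_seriesE.
rewrite [RHS]/= /cycle_component; have [->|r0] := posnP r.
  by rewrite /conn_sum big1 ?scaler0 // => s; rewrite /sys_connected card_ord.
rewrite /weight -mul2n.
apply: scale_fact_div; first by rewrite muln_gt0.
rewrite -conn_sum_cycle //; congr (_ *+ _); apply: conn_sum_card.
by rewrite card_prod card_ord card_bool card_ord mulnC.
Qed.

End CycleSeries.

(** * Closing the open flags *)
Section Matchings.
Implicit Types T U : finType.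

Lemma matchingK T (m : matching T) : involutive m.
Proof. by move=> x; have /forallP /(_ x) /andP[/eqP] := mateP m. Qed.

Lemma matching_neq T (m : matching T) x : m x != x.
Proof. by have /forallP /(_ x) /andP[] := mateP m. Qed.

Lemma matching_eq T (m n : matching T) : m =1 n -> m = n.
Proof. by move=> mn; apply/val_inj/ffunP. Qed.

Section Build.
Variables (T : finType) (f : T -> T).
Hypotheses (fK : involutive f) (fN : forall x, f x != x).

Lemma build_matching_proof : [forall x, (finfun f (finfun f x) == x) && (finfun f x != x)].
Proof. by apply/forallP => x; rewrite !ffunE fK eqxx fN. Qed.

Definition build_matching : matching T := Matching build_matching_proof.

Lemma build_matchingE x : build_matching x = f x.
Proof. by rewrite /= ffunE. Qed.
End Build.

Section Map.
Variables (T U : finType) (h : T -> U) (g : U -> T).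
Hypotheses (hK : cancel h g) (gK : cancel g h).

Lemma map_matchingK (m : matching T) : involutive (fun x => h (m (g x))).
Proof. by move=> x; rewrite hK matchingK gK. Qed.

Lemma map_matching_neq (m : matching T) x : h (m (g x)) != x.
Proof. by rewrite -(inj_eq (can_inj gK)) hK matching_neq. Qed.

Definition map_matching (m : matching T) : matching U :=
  build_matching (map_matchingK m) (map_matching_neq m).

Lemma map_matchingE m x : map_matching m x = h (m (g x)).
Proof. exact: build_matchingE. Qed.
End Map.

Lemma map_matching_can T U (h : T -> U) (g : U -> T)
    (hK : cancel h g) (gK : cancel g h) :
  cancel (map_matching hK gK) (map_matching gK hK).
Proof. by move=> m; apply: matching_eq => x; rewrite !map_matchingE !hK. Qed.

End Matchings.

Section GlueIso.
Variables (V F V' F' : finType) (G : ctgraph true V F) (H : ctgraph true V' F').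
Variables (fv : V -> V') (ff : F -> F').
Hypotheses (bv : bijective fv) (bf : bijective ff) (GH : is_morph G H fv ff).

Lemma open_morph f : (theta H (ff f) == ff f) = (theta G f == f).
Proof. by have /is_morphP[<- _ _] := GH; rewrite (inj_eq (bij_inj bf)). Qed.

Lemma glue_iso (l : matching (open_flag G)) (m : matching (open_flag H)) :
    (forall x y, val y = ff (val x) -> val (m y) = ff (val (l x))) ->
  iso (glue l) (glue m).
Proof.
move=> lm; exists fv, ff; split=> //; have /is_morphP[Ht Ha Hr] := GH.
apply/is_morphP; split=> // f; rewrite /= !ffunE /glue_theta.
case: insubP => [x fx xf|fN]; case: insubP => [y fy yf|].
- by apply/esym/lm; rewrite yf xf.
- by rewrite open_morph fx.
- by rewrite open_morph (negbTE fN) in fy.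
- by rewrite Ht.
Qed.

End GlueIso.

Section ClosureClass.
Variable R : realType.

Definition matching_sum (V F : finType) (G : ctgraph true V F) :
    {malg R[graph_class false]} :=
  \sum_(l : matching (open_flag G)) << gclass (glue l) >>.

(** An isomorphism of open graphs identifies their open flags, hence the
    matchings, so the closure of a class can be computed on any of its
    graphs. *)
Lemma matching_sum_iso (V F V' F' : finType) (G : ctgraph true V F)
  (H : ctgraph true V' F') : iso G H -> matching_sum G = matching_sum H.
Proof.
case=> fv [ff] [bv bf GH]; have [gf ffK gfK] := bf.
have hP (x : open_flag G) : theta H (ff (val x)) == ff (val x).
  by rewrite (open_morph bf GH) (valP x).
have gP (y : open_flag H) : theta G (gf (val y)) == gf (val y).
  by rewrite -(open_morph bf GH) gfK (valP y).
pose h (x : open_flag G) : open_flag H := exist _ (ff (val x)) (hP x).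
pose g (y : open_flag H) : open_flag G := exist _ (gf (val y)) (gP y).
have hK : cancel h g by move=> x; apply: val_inj; rewrite /= ffK.
have gK : cancel g h by move=> x; apply: val_inj; rewrite /= gfK.
rewrite [RHS](reindex (map_matching hK gK)) /=; last first.
  by exists (map_matching gK hK) => l _; apply: map_matching_can.
apply: eq_bigr => l _; congr << _ >>; apply/gclassP.
apply: (glue_iso bv bf GH) => x y yx.
rewrite map_matchingE /=; congr (ff (val (l _))).
by apply: val_inj; rewrite /= yx ffK.
Qed.

Lemma closure_class_gclass (V F : finType) (G : ctgraph true V F) :
  closure_class R (gclass G) = matching_sum G.
Proof. by apply/matching_sum_iso/iso_sym/rep_gclass. Qed.

End ClosureClass.

Section CloseSystem.
Variables (V : finType).

Section Close.
Variables (s : edge_system true V) (m : matching V).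

Definition close_mate (i : option bool) (x : V) : V :=
  if i == Some true then m x else s i x.

Lemma close_mateK i : involutive (close_mate i).
Proof. by move=> x; rewrite /close_mate; case: eqP => _; rewrite ?matchingK ?matesK. Qed.

Lemma close_mate_fix i x : (close_mate i x == x) = false && (i == Some true).
Proof.
rewrite /close_mate; have [_|iN] := eqVneq i (Some true).
  by apply: negbTE; apply: matching_neq.
by rewrite mates_fix (negbTE iN).
Qed.

Definition close_system : edge_system false V :=
  build_system close_mateK close_mate_fix.

Lemma close_systemE i x : close_system i x = close_mate i x.
Proof. exact: build_systemE. Qed.

End Close.

Section Open.
Variable t : edge_system false V.

Definition open_mate (i : option bool) (x : V) : V :=
  if i == Some true then x else t i x.

Lemma open_mateK i : involutive (open_mate i).
Proof. by move=> x; rewrite /open_mate; case: eqP => _ //; rewrite matesK. Qed.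

Lemma open_mate_fix i x : (open_mate i x == x) = true && (i == Some true).
Proof.
rewrite /open_mate; have [_|iN] := eqVneq i (Some true); first by rewrite eqxx.
by rewrite mates_fix.
Qed.

Definition open_system : edge_system true V :=
  build_system open_mateK open_mate_fix.

Lemma open_systemE i x : open_system i x = open_mate i x.
Proof. exact: build_systemE. Qed.

Definition last_matching : matching V :=
  build_matching (matesK t (Some true)) (fun x => mates_neq t x isT).

Lemma last_matchingE x : last_matching x = t (Some true) x.
Proof. exact: build_matchingE. Qed.

End Open.

Lemma close_system_bij :
  bijective (fun sm : edge_system true V * matching V => close_system sm.1 sm.2).
Proof.
exists (fun t => (open_system t, last_matching t)) => [[s m]|t] /=.
  congr (_, _).
    apply: edge_system_eq => i x; rewrite open_systemE /open_mate.
    have [->|iN] := eqVneq i (Some true).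
      by apply/esym/eqP; rewrite mates_fix.
    by rewrite close_systemE /close_mate (negbTE iN).
  by apply: matching_eq => x; rewrite last_matchingE close_systemE.
apply: edge_system_eq => i x; rewrite close_systemE /close_mate.
have [->|iN] := eqVneq i (Some true); first exact: last_matchingE.
by rewrite open_systemE /open_mate (negbTE iN).
Qed.

Variable R : realType.

Lemma matching_sum_system (s : edge_system true V) :
  matching_sum R (system_ctgraph s) =
  \sum_(m : matching V) << sys_class (close_system s m) >>.
Proof.
have hP (x : V) : theta (system_graph s) (x, Some true) == (x, Some true).
  by rewrite ffunE xpair_eqE eqxx andbT mates_fix.
pose h (x : V) : open_flag (system_ctgraph s) :=
    exist _ (x, Some true) (hP x).
pose g (f : open_flag (system_ctgraph s)) := (val f).1.
have hK : cancel h g by [].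
have gK : cancel g h.
  move=> [[x i] xi]; apply: val_inj; rewrite /g /=; congr (_, _).
  move: xi; rewrite /= ffunE xpair_eqE eqxx andbT mates_fix.
  by move/eqP.
rewrite [LHS](reindex (map_matching hK gK)) /=; last first.
  by exists (map_matching gK hK) => l _; apply: map_matching_can.
apply: eq_bigr => m _; congr << _ >>; apply/gclassP.
exists id, id; split; [by exists id | by exists id |].
apply/is_morphP; split=> // -[x i]; rewrite /= !ffunE /=.
rewrite /glue_theta /close_mate; case: insubP => [f fo fE|].
  move: (fo); rewrite ffunE xpair_eqE eqxx andbT mates_fix => /eqP /= iT.
  by rewrite ffunE /= /g fE iT eqxx.
by rewrite ffunE xpair_eqE eqxx andbT mates_fix => /= /negbTE ->.
Qed.

Lemma sum_closure_systems :
  \sum_(s : edge_system true V) closure_class R (sys_class s) = sys_sum R false V.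
Proof.
under eq_bigr do rewrite closure_class_gclass matching_sum_system.
rewrite pair_bigA /sys_sum /=.
by rewrite [RHS](reindex _ (onW_bij _ close_system_bij)).
Qed.

End CloseSystem.

(** Linearity of the extension of [h] to the monoid algebra, for sums of
    generators with repetitions, such as the terms of [sys_series]. *)
Lemma linear_extension_sum (R : nzRingType) (K : choiceType) (M : lmodType R)
    (I : finType) (u : I -> K) (h : K -> M) (a : R) (x : {malg R[K]}) :
    x = a *: \sum_i << u i >> ->
  \sum_(c <- msupp x) x@_c *: h c = a *: \sum_i h (u i).
Proof.
move=> xE; pose d := [fset u i | i in I]%fset.
have ud i : u i \in d by apply: in_imfset.
have xc c : x@_c = a * \sum_i (u i == c)%:R.
  rewrite xE mcoeffZ raddf_sum; congr (_ * _).
  by apply: eq_bigr => i _; rewrite /= mcoeffU.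
have xd : (msupp x `<=` d)%fset.
  apply/fsubsetP => c; rewrite -mcoeff_neq0 xc; apply: contraR => cd.
  rewrite big1 ?mulr0 // => i _; case: eqP => // uic.
  by rewrite -uic ud in cd.
rewrite (big_fset_incl _ xd) => [|c _ /mcoeff_outdom ->]; last by rewrite scale0r.
rewrite scaler_sumr.
transitivity (\sum_(c <- d) \sum_i (a * (u i == c)%:R) *: h c).
  by apply: eq_bigr => c _; rewrite xc mulr_sumr scaler_suml.
rewrite exchange_big; apply: eq_bigr => i _ /=.
rewrite (big_fsetD1 (u i)) //= eqxx mulr1 big1_fset ?addr0 // => c.
rewrite in_fsetD1 => /andP[/negbTE cN _] _.
by rewrite eq_sym cN mulr0 scale0r.
Qed.

Section ClosureSeries.
Variable R : realType.

Lemma closure_sys_series : compl_closure (sys_series R true) = sys_series R false.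
Proof.
apply: completion_eq => n; rewrite sys_seriesE -sum_closure_systems.
exact: linear_extension_sum.
Qed.

End ClosureSeries.

(** * Counting the edge systems of a graph *)
Lemma is_morph_comp (V F V' F' V'' F'' : finType) (G : flag_graph V F)
    (H : flag_graph V' F') (K : flag_graph V'' F'') fv ff gv gf :
  is_morph G H fv ff -> is_morph H K gv gf -> is_morph G K (gv \o fv) (gf \o ff).
Proof.
move=> /is_morphP[H1 H2 H3] /is_morphP[K1 K2 K3].
by apply/is_morphP; split=> f /=; rewrite ?H1 ?K1 ?H2 ?K2 ?K3 ?H3.
Qed.

Lemma is_morph_inv (V F V' F' : finType) (G : flag_graph V F)
    (H : flag_graph V' F') fv ff gv gf :
  cancel fv gv -> cancel gv fv -> cancel ff gf -> cancel gf ff ->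
  is_morph G H fv ff -> is_morph H G gv gf.
Proof.
move=> fvK gvK ffK gfK /is_morphP[H1 H2 H3].
apply/is_morphP; split=> f.
- by apply: (can_inj ffK); rewrite H1 !gfK.
- by apply: (can_inj fvK); rewrite H2 !gfK gvK.
- by rewrite -H3 gfK.
Qed.

Lemma is_morph_ext (V F V' F' : finType) (G : flag_graph V F)
    (H : flag_graph V' F') fv ff gv gf :
  fv =1 gv -> ff =1 gf -> is_morph G H fv ff -> is_morph G H gv gf.
Proof.
move=> fvE ffE /is_morphP[H1 H2 H3]; apply/is_morphP.
by split=> f; rewrite -?ffE -?fvE.
Qed.

Section Presentations.
Variables (V F : finType) (G : ctgraph false V F).
Local Notation LF := (V * option bool)%type.
Implicit Types (s : edge_system false V) (p : {perm V}).

(** The permutation [p] is the effect on vertices of an isomorphism from the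
    graph of [s] to [G]. *)
Definition presents s p :=
  [exists q : {ffun LF -> F}, injectiveb q && is_morph (system_graph s) G p q].

Lemma card_labelled_flags : #|{: LF}| = #|F|.
Proof. by rewrite card_prod card_option card_bool (card_flags G) mulnC. Qed.

Lemma presentsP s p :
  reflect (exists q : LF -> F, bijective q /\ is_morph (system_graph s) G p q)
          (presents s p).
Proof.
apply: (iffP existsP) => [[q /andP[/injectiveP qI qM]]|[q [qB qM]]].
  by exists q; split=> //; apply: inj_card_bij; rewrite ?card_labelled_flags.
exists (finfun q); apply/andP; split.
  by apply/injectiveP => f g; rewrite !ffunE; apply: (bij_inj qB).
by apply: is_morph_ext qM => // f; rewrite ffunE.
Qed.

Lemma iso_presents s :
  iso (system_ctgraph s) G <-> exists p, presents s p.
Proof.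
split=> [[fv [ff [bv bf M]]]|[p /presentsP[q [qB qM]]]]; last first.
  by exists p, q; split=> //; exists p^-1%g; [apply: permK | apply: permKV].
exists (perm (bij_inj bv)); apply/presentsP; exists ff; split=> //.
by apply: is_morph_ext M => // x; rewrite permE.
Qed.

Lemma presents_aut s p a :
  presents s p -> presents s (p * a)%g = (a \in Aut_bar G).
Proof.
move=> /presentsP[q [qB qM]]; have [q' qK q'K] := qB.
rewrite inE; apply/presentsP/existsP => [[u [[u' uK u'K] uM]]|[u uM]].
  have uI : injective (u \o q').
    exact: inj_comp (can_inj uK) (can_inj q'K).
  exists (perm uI).
  apply: is_morph_ext (is_morph_comp
    (is_morph_inv (permK p) (permKV p) qK q'K qM) uM) => x /=.
    by rewrite permM permKV.
  by rewrite permE.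
exists (u \o q); split.
  by apply: bij_comp => //; exists u^-1%g; [apply: permK | apply: permKV].
by apply: is_morph_ext (is_morph_comp qM uM) => // x; rewrite permM.
Qed.

Lemma card_presents s p0 : presents s p0 -> #|[set p | presents s p]| = #|Aut_bar G|.
Proof.
move=> sp0; rewrite -[RHS](card_imset _ (mulgI p0)); apply: eq_card => p; rewrite inE.
apply/idP/imsetP => [sp|[a aA ->]]; last by rewrite presents_aut.
by exists (p0^-1 * p)%g; rewrite ?mulKVg // -(presents_aut _ sp0) mulKVg.
Qed.

Lemma presents_map s p :
  presents (map_system (permK p) (permKV p) s) 1%g = presents s p.
Proof.
have hM : is_morph (system_graph s)
    (system_graph (map_system (permK p) (permKV p) s)) p (fun f => (p f.1, f.2)).
  apply/is_morphP; split=> -[x i]; rewrite ?inE //=; last by rewrite !ffunE.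
  by rewrite !ffunE /= ?ffunE /= permK.
have hK : cancel (fun f : LF => (p f.1, f.2)) (fun f => ((p^-1)%g f.1, f.2)).
  by case=> x i /=; rewrite permK.
have h'K : cancel (fun f : LF => ((p^-1)%g f.1, f.2)) (fun f => (p f.1, f.2)).
  by case=> x i /=; rewrite permKV.
apply/presentsP/presentsP => -[q [qB qM]].
  exists (q \o (fun f => (p f.1, f.2))); split.
    by apply: bij_comp => //; exists (fun f => ((p^-1)%g f.1, f.2)).
  by apply: is_morph_ext (is_morph_comp hM qM) => // x; rewrite /= perm1.
exists (q \o (fun f => ((p^-1)%g f.1, f.2))); split.
  by apply: bij_comp => //; exists (fun f => (p f.1, f.2)).
apply: is_morph_ext (is_morph_comp
  (is_morph_inv (permK p) (permKV p) hK h'K hM) qM) => // x.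
by rewrite /= permKV perm1.
Qed.

Definition graph_systems := [set s | [exists p, presents s p]].
(** These are the alternating colourings of the black edges of [G] by
    [Some false] and [Some true], up to exchanging parallel edges, which the
    vertices do not see. *)
Definition colourings := [set s | presents s 1%g].

(** Double counting of the pairs [(s, p)] such that [p] presents [s]: for fixed
    [s] they form a torsor under [Aut_bar G], and for fixed [p] transport along
    [p] identifies them with the colourings. *)
Lemma card_graph_systems :
  (#|graph_systems| * #|Aut_bar G| = (#|V|)`! * #|colourings|)%N.
Proof.
transitivity (\sum_s \sum_(p | presents s p) 1)%N.
  rewrite (bigID (mem graph_systems)) /= [X in _ = (_ + X)%N]big1 ?addn0.
    rewrite -sum_nat_const; apply: eq_bigr => s.
    rewrite inE => /existsP[p0 sp0]; rewrite -(card_presents sp0) -sum1_card.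
    by apply: eq_bigl => p; rewrite inE.
  move=> s; rewrite inE => /existsPn sN.
  by apply: big_pred0 => p; apply/negbTE.
rewrite (exchange_big_dep predT) //= -card_perm_type -sum_nat_const.
rewrite [RHS](eq_bigl predT) //; apply: eq_bigr => p _; rewrite sum1dep_card.
rewrite -[RHS](card_imset _ (can_inj (map_system_can (permKV p) (permK p)))).
apply: eq_card => s; rewrite inE -presents_map.
apply/idP/imsetP => [sp|[t + ->]].
  exists (map_system (permK p) (permKV p) s); first by rewrite inE.
  by rewrite map_system_can.
by rewrite inE (map_system_can (permKV p) (permK p)).
Qed.

End Presentations.

(** * Colourings of the black edges *)
Section Colourings.
Variables (V F : finType) (G : ctgraph false V F).
Local Notation LF := (V * option bool)%type.
Implicit Types s : edge_system false V.

Lemma colouringP s : reflect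
  (exists q : LF -> F, [/\ bijective q,
    forall x i, theta G (q (x, i)) = q (s i x, i),
    forall x i, attach G (q (x, i)) = x &
    forall x i, (q (x, i) \in red G) = (i == None)])
  (s \in colourings G).
Proof.
rewrite inE; apply: (iffP (presentsP _ _ _)) => -[q].
  case=> qB /is_morphP[H1 H2 H3]; exists q; split=> // x i.
  - by rewrite -H1 /= ffunE.
  - by rewrite -H2 /= ffunE perm1.
  - by rewrite H3 /= inE.
case=> qB H1 H2 H3; exists q; split=> //.
apply/is_morphP; split=> -[x i].
- by rewrite H1 /= ffunE.
- by rewrite H2 /= ffunE perm1.
- by rewrite H3 /= inE.
Qed.

Definition black_cycle (x : V) := [set y | connect (black_adj G) x y].

Lemma black_cycleP (C : {set V}) :
  reflect (exists x, C = black_cycle x) (C \in black_cycles G).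
Proof. by apply: (iffP imsetP) => [[x _ ->]|[x ->]]; exists x. Qed.

Lemma connect_black_ind (P : pred V) x y :
  P x -> (forall u v, P u -> black_adj G u v -> P v) ->
  connect (black_adj G) x y -> P y.
Proof.
move=> Px PS /connectP[p xp ->]; elim: p x Px xp => //= z p IHp x Px.
by case/andP=> xz; apply/IHp/(PS x).
Qed.

Section Fixed.
Variable s0 : edge_system false V.
Hypothesis s0G : s0 \in colourings G.

Lemma black_adjP u v :
  reflect (exists c, s0 (Some c) u = v) (black_adj G u v).
Proof.
apply: (iffP existsP) => [[f /and3P[fN /eqP fu /eqP fv]]|[c cv]];
  have /colouringP[q [[q' qK q'K] H1 H2 H3]] := s0G.
  have := q'K f; case: (q' f) => x [c|] fE; last first.
    by rewrite -fE H3 eqxx in fN.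
  exists c; rewrite -fv -fu -fE H1 !H2.
  by [].
by exists (q (u, Some c)); rewrite H3 H1 !H2 cv !eqxx.
Qed.

Lemma black_adj_sym : connect_sym (black_adj G).
Proof.
apply: sym_connect_sym => u v.
by apply/idP/idP => /black_adjP[c <-]; apply/black_adjP; exists c; rewrite matesK.
Qed.

Lemma black_cycle_mates c x : black_cycle (s0 (Some c) x) = black_cycle x.
Proof.
apply/setP => y; rewrite !inE; apply: same_connect; first exact: black_adj_sym.
by rewrite black_adj_sym connect1 //; apply/black_adjP; exists c.
Qed.

(** The first colour pairs off the vertices of each black cycle. *)
Lemma black_cycle_even x : ~~ odd #|black_cycle x|.
Proof.
have sP (y : {y | y \in black_cycle x}) : s0 (Some false) (val y) \in black_cycle x.
  have : val y \in black_cycle x by apply: valP y.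
  rewrite !inE => xy; apply: connect_trans xy (connect1 _).
  by apply/black_adjP; exists false.
pose f y : {y | y \in black_cycle x} := exist _ (s0 (Some false) (val y)) (sP y).
have fK : involutive f by move=> y; apply: val_inj; rewrite /= matesK.
have := odd_card_involution fK; rewrite card_sig (eq_card (B := black_cycle x)) //.
by apply=> y; rewrite -val_eqE mates_neq.
Qed.

Lemma long_black_cycle x :
  s0 (Some false) x != s0 (Some true) x -> (2 < #|black_cycle x|)%N.
Proof.
move=> xN; have : [set x; s0 (Some false) x; s0 (Some true) x] \subset black_cycle x.
  apply/subsetP => y; rewrite !inE.
  by case/orP=> [/orP[] |] /eqP ->; rewrite ?connect0 // connect1 //;
    apply/black_adjP; [exists false | exists true].
move/subset_leq_card; apply: leq_trans; rewrite -setUA cardsU1 cards2 xN !inE.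
by rewrite !(eq_sym x) !mates_fix.
Qed.

Lemma short_black_cycle x :
  s0 (Some false) x = s0 (Some true) x -> (#|black_cycle x| <= 2)%N.
Proof.
move=> xE; have : black_cycle x \subset [set x; s0 (Some false) x].
  apply/subsetP => y; rewrite inE.
  apply: (connect_black_ind (P := mem [set x; s0 (Some false) x])).
    by rewrite /= !inE eqxx.
  move=> u v /=; rewrite !inE => /orP[] /eqP -> /black_adjP[[] <-].
  - by rewrite xE eqxx orbT.
  - by rewrite eqxx orbT.
  - by rewrite xE matesK eqxx.
  - by rewrite matesK eqxx.
by move/subset_leq_card/leq_trans; apply; rewrite cards2; case: eqP.
Qed.

Section Swap.
Variable A : {set {set V}}.

Definition swap_mate (i : option bool) (x : V) : V :=
  if i is Some c then s0 (Some (c (+) (black_cycle x \in A))) x else s0 None x.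

Lemma swap_mateK i : involutive (swap_mate i).
Proof.
by case: i => [c|] x /=; rewrite ?black_cycle_mates matesK.
Qed.

Lemma swap_mate_fix i x : (swap_mate i x == x) = false && (i == Some true).
Proof. by case: i => [c|] /=; rewrite mates_fix. Qed.

Definition swap_system : edge_system false V :=
  build_system swap_mateK swap_mate_fix.

Lemma swap_systemE i x : swap_system i x = swap_mate i x.
Proof. exact: build_systemE. Qed.

Lemma swap_system_colouring : swap_system \in colourings G.
Proof.
have /colouringP[q [[q' qK q'K] H1 H2 H3]] := s0G.
pose t (f : LF) : LF :=
  (f.1, if f.2 is Some c then Some (c (+) (black_cycle f.1 \in A)) else None).
have tK : involutive t by case=> x [c|]; rewrite /t //= -addbA addbb addbF.
apply/colouringP; exists (q \o t); split.
- by apply: bij_comp; [exists q' | exists t].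
- move=> x i; rewrite swap_systemE /= /t /= H1.
  by case: i => [c|] //=; rewrite black_cycle_mates.
- by move=> x i; rewrite /= H2.
- by move=> x i; rewrite /= H3; case: i.
Qed.

End Swap.

Section Compare.
Variable s : edge_system false V.
Hypothesis sG : s \in colourings G.

Lemma colouring_None x : s None x = s0 None x.
Proof.
have /colouringP[q [_ H1 H2 H3]] := sG.
have /colouringP[r [[r' rK r'K] K1 K2 K3]] := s0G.
have qr : q (x, None) = r (x, None).
  have := r'K (q (x, None)); case: (r' _) => y i E.
  have := H2 x None; rewrite -{1}E K2 => yx.
  have := H3 x None; rewrite -{1}E K3 eqxx => /eqP iN.
  by rewrite -E yx iN.
by rewrite -(H2 (s None x) None) -H1 qr K1 K2.
Qed.

(** The two black flags at [x] are the same in both colourings, so the colours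
    either agree at [x] or are exchanged. *)
Lemma colouring_Some x :
  exists e, forall c, s (Some c) x = s0 (Some (c (+) e)) x.
Proof.
have /colouringP[q [qB H1 H2 H3]] := sG.
have /colouringP[r [[r' rK r'K] K1 K2 K3]] := s0G.
have qr c : exists d, q (x, Some c) = r (x, Some d).
  have := r'K (q (x, Some c)); case: (r' _) => y i E.
  have := H2 x (Some c); rewrite -{1}E K2 => yx.
  have := H3 x (Some c); rewrite -{1}E K3; case: i E => // d E _.
  by exists d; rewrite -E yx.
have [[e qf] [d qt]] := (qr false, qr true).
have dNe : d != e.
  by apply/eqP => de; rewrite de -qf in qt; have := bij_inj qB qt.
have de : d = ~~ e by case: (d) (e) dNe => [] [].
exists e => c; rewrite -(H2 (s (Some c) x) (Some c)) -H1.
have -> : q (x, Some c) = r (x, Some (c (+) e)) by case: c; rewrite ?qf // qt de.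
by rewrite K1 K2.
Qed.

Definition agree x := s (Some false) x == s0 (Some false) x.

Lemma agreeP c x : reflect (forall d, s (Some d) x = s0 (Some d) x)
  (s (Some c) x == s0 (Some c) x).
Proof.
apply: (iffP eqP) => [E d|//]; have [e eE] := colouring_Some x.
case: e eE => eE; last by rewrite eE addbF.
have [-> //|dc] := eqVneq d c; have -> : d = ~~ c by case: c d dc {E} => [] [].
by rewrite eE addbT negbK -E eE addbT.
Qed.

(** If both colourings send [u] along the same edge to [v], they also agree on
    that edge at [v], hence on both edges at [v]. *)
Lemma agree_cycle x y : y \in black_cycle x -> agree y = agree x.
Proof.
have agree1 u c : agree u -> agree (s0 (Some c) u).
  move/agreeP => su.
  have /agreeP aE : s (Some c) (s0 (Some c) u) == s0 (Some c) (s0 (Some c) u).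
    by rewrite [X in _ == X]matesK -su matesK.
  by rewrite /agree aE.
rewrite inE => xy.
suff /eqP : agree y == agree x by [].
move: xy; apply: (connect_black_ind (P := fun y => agree y == agree x)) => //.
move=> u v /eqP <- /black_adjP[c <-]; apply/eqP; apply/idP/idP; last exact: agree1.
by move/(agree1 _ c); rewrite matesK.
Qed.

Definition swapped := [set black_cycle x | x in [set x | ~~ agree x]].

Lemma swap_swapped : swap_system swapped = s.
Proof.
apply: edge_system_eq => -[c|] x; rewrite swap_systemE /= ?colouring_None //.
have -> : (black_cycle x \in swapped) = ~~ agree x.
  apply/imsetP/idP => [[y yN xy]|xN]; last by exists x; rewrite ?inE.
  by rewrite inE in yN; rewrite (@agree_cycle y x) // -xy inE connect0.
have [/agreeP ->|xN] := boolP (agree x); first by rewrite addbF.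
have [e eE] := colouring_Some x; rewrite eE; case: e eE => // eE.
by rewrite /agree eE eqxx in xN.
Qed.

Lemma swapped_long : swapped \subset [set C in black_cycles G | (2 < #|C|)%N].
Proof.
apply/subsetP => C /imsetP[x]; rewrite inE => xN ->; rewrite inE.
apply/andP; split; first by apply/black_cycleP; exists x.
apply: long_black_cycle; apply: contra xN => /eqP E.
have [e eE] := colouring_Some x; rewrite /agree eE; case: e eE => // _.
by rewrite E.
Qed.

End Compare.

(** Exchanging colours on a short cycle has no effect, since both involutions
    coincide there; on a long cycle they differ at every vertex. *)
Lemma card_colourings : #|colourings G| = (2 ^ long_cycles G)%N.
Proof.
rewrite /long_cycles -card_powerset -[RHS](card_in_imset (f := swap_system)).
  apply: eq_card => s; apply/idP/imsetP => [sG|[A _ ->]]; last first.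
    exact: swap_system_colouring.
  by exists (swapped s); rewrite ?swap_swapped // inE swapped_long.
suff sub (A B : {set {set V}}) :
    A \subset [set C in black_cycles G | (2 < #|C|)%N] ->
    swap_system A = swap_system B -> A \subset B.
  move=> A B; rewrite !powersetE => hA hB AB; apply/eqP; rewrite eqEsubset.
  by rewrite (sub _ _ hA AB) (sub _ _ hB (esym AB)).
move=> /subsetP hA AB; apply/subsetP => C CA.
have := hA C CA; rewrite inE => /andP[/black_cycleP[x Cx] Clong].
apply: contraLR Clong => CB; rewrite -leqNgt Cx; apply: short_black_cycle.
have := congr1 (fun s : edge_system false V => s (Some true) x) AB.
by rewrite !swap_systemE /= -Cx CA (negbTE CB).
Qed.

End Fixed.
End Colourings.

(** * Existence of a colouring *)
Section AlternatingColouring.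
Variables (T : finType) (a b : T -> T).
Hypotheses (aK : involutive a) (bK : involutive b).
Hypotheses (aN : forall x, a x != x) (bN : forall x, b x != x).

(** Colour one of the two rotation orbits of each dihedral orbit by the parity
    of the distance from its root, which is consistent as the orbit has even
    length, and let [b] invert the colours on the other one. *)
Lemma alternating_colouring :
    (forall x, ~~ odd (fingraph.order (rot a b) x)) ->
  exists e : T -> bool, (forall x, e (a x) = e x) /\ (forall x, e (b x) = ~~ e x).
Proof.
move=> order_even; pose rt := rot a b; have rI : injective rt := rot_inj aK bK.
have rsym := fconnect_sym rI.
pose p x := odd (findex rt (froot rt x) x).
have p_rot x : p (rt x) = ~~ p x.
  have rE : froot rt (rt x) = froot rt x.
    by apply/esym/eqP; rewrite root_connect // fconnect1.
  rewrite /p rE; set r := froot rt x.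
  have rx : fconnect rt r x by rewrite /r rsym connect_root.
  have nlt := findex_max rx; set n := findex rt r x in nlt *.
  have xE : rt x = iter n.+1 rt r by rewrite /= iter_findex.
  have [n1|] := ltnP n.+1 (fingraph.order rt r).
    by rewrite xE findex_iter.
  rewrite leq_eqVlt ltnS leqNgt nlt orbF => /eqP n1.
  rewrite xE -n1 iter_order // findex0.
  by have := order_even r; rewrite n1 /= negbK => ->.
(* Any choice of one orbit from each exchanged pair will do; the enumeration
   of [T] provides one. *)
pose sel x := (enum_rank (froot rt x) < enum_rank (froot rt (b x)))%N.
have sel_b x : sel (b x) = ~~ sel x.
  rewrite /sel bK -leqNgt ltn_neqAle andb_idl // => _.
  rewrite (inj_eq val_inj) (inj_eq enum_rank_inj) root_connect // rsym.
  exact: rot_orbit_reflection.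
have sel_rot x : sel (rt x) = sel x.
  have rx : froot rt (rt x) = froot rt x.
    by apply/esym/eqP; rewrite root_connect // fconnect1.
  rewrite /sel rx; suff -> : froot rt (b (rt x)) = froot rt (b x) by [].
  apply/eqP; rewrite root_connect //.
  suff -> : b x = rt (b (rt x)) by apply: fconnect1.
  by rewrite /rt /rot bK aK.
pose e x := if sel x then p x else ~~ p (b x).
have e_b x : e (b x) = ~~ e x.
  by rewrite /e sel_b bK; case: (sel x); rewrite //= negbK.
exists e; split=> // x.
have e_rot y : e (rt y) = ~~ e y.
  rewrite /e sel_rot p_rot; case: (sel y) => //.
  suff -> : b y = rt (b (rt y)) by rewrite p_rot negbK.
  by rewrite /rt /rot bK aK.
by rewrite -[x in a x]bK -/(rot a b (b x)) e_rot e_b negbK.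
Qed.

End AlternatingColouring.

Section ColouringExistence.
Variables (V F : finType) (G : ctgraph false V F).
Local Notation LF := (V * option bool)%type.

Let T : finType := {f : F | f \notin red G}.

Let thetaK f : theta G (theta G f) = f.
Proof. by have /colored_trivalentP[H _ _ _ _] := ctvalP G. Qed.

Let theta_neq f : theta G f != f.
Proof.
have /colored_trivalentP[_ H _ _ _] := ctvalP G.
by apply/eqP => /H[].
Qed.

Let theta_red f : (theta G f \in red G) = (f \in red G).
Proof. by have /colored_trivalentP[_ _ H _ _] := ctvalP G. Qed.

Lemma red_flag_unique f g :
  f \in red G -> g \in red G -> attach G f = attach G g -> f = g.
Proof.
have /colored_trivalentP[_ _ _ _ H] := ctvalP G => fr gr fg.
have /eqP/cards1P[h hE] := H (attach G f).
have : f \in [set f' in red G | attach G f' == attach G f] by rewrite inE fr eqxx.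
have : g \in [set f' in red G | attach G f' == attach G f] by rewrite inE gr fg eqxx.
by rewrite hE !inE => /eqP -> /eqP ->.
Qed.

Lemma other_black_flag (f : T) : exists g : T, [/\ g != f,
  attach G (val g) = attach G (val f) &
  forall h : T, attach G (val h) = attach G (val f) -> h = f \/ h = g].
Proof.
have /colored_trivalentP[_ _ _ H3 H1] := ctvalP G.
pose v := attach G (val f); pose B := [set g | attach G g == v] :\: red G.
have cB : #|B| = 2.
  have := cardsID (red G) [set g | attach G g == v].
  rewrite H3 (_ : _ :&: _ = [set g in red G | attach G g == v]) ?H1.
    by move/eqP; rewrite add1n eqSS => /eqP.
  by apply/setP => g; rewrite !inE andbC.
have fB : val f \in B by rewrite !inE eqxx andbT; apply: valP f.
have := cardsD1 (val f) B; rewrite cB fB add1n => -[] /esym/eqP/cards1P[g gE].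
have : g \in B :\ val f by rewrite gE inE.
rewrite !inE => /and3P[gf gN /eqP gv].
exists (exist _ g gN); split=> // h hv.
have [->|hf] := eqVneq h f; [by left | right; apply: val_inj => /=].
have : val h \in B :\ val f.
  by rewrite !inE hv eqxx -(inj_eq val_inj) in hf *; rewrite hf andbT; apply: valP h.
by rewrite gE inE => /eqP.
Qed.

Section WithOther.
Variable b : T -> T.
Hypothesis b_neq : forall f, b f != f.
Hypothesis b_attach : forall f, attach G (val (b f)) = attach G (val f).
Hypothesis b_unique : forall f h : T,
  attach G (val h) = attach G (val f) -> h = f \/ h = b f.

Let a_proof (f : T) : theta G (val f) \notin red G.
Proof. by rewrite theta_red; apply: valP f. Qed.

Let a (f : T) : T := exist _ (theta G (val f)) (a_proof f).

Let aK : involutive a.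
Proof. by move=> f; apply: val_inj; rewrite /= thetaK. Qed.

Let aN f : a f != f.
Proof. by rewrite -val_eqE theta_neq. Qed.

Let bK : involutive b.
Proof.
move=> f; case: (b_unique (f := b f) (h := f)) => // E.
by have := b_neq f; rewrite -E eqxx.
Qed.

(** The involutions on the black flags are [a], to the other end of the edge,
    and [b], to the other black flag at the vertex.  A rotation orbit contains
    one of the two black flags at each vertex of the black cycle. *)
Lemma order_black_cycle f :
  fingraph.order (rot a b) f = #|black_cycle G (attach G (val f))|.
Proof.
pose at_ (g : T) := attach G (val g).
rewrite -card_rot_orbit -(card_in_imset (f := at_)); last first.
  move=> g h; rewrite !inE => fg fh /b_unique[//|hg].
  have /negP[] := rot_orbit_reflection aK bK aN b_neq h; rewrite -hg.
  by apply: connect_trans fg; rewrite (fconnect_sym (rot_inj aK bK)).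
have at_b g : at_ (b g) = at_ g by apply: b_attach.
apply: eq_card => v; apply/imsetP/idP => [[g + ->]|].
  rewrite inE => /iter_findex <-; rewrite inE.
  elim: (findex _ _ _) => [|n IHn] /=; first exact: connect0.
  apply: connect_trans IHn (connect1 _); set h := iter _ _ _.
  apply/existsP; exists (val (b h)).
  by rewrite (valP (b h)) -/(at_ _) at_b /= !eqxx.
rewrite inE => fv.
suff : v \in [set at_ g | g in rot_orbit a b f] by case/imsetP=> g; exists g.
move: fv; apply: (connect_black_ind
  (P := fun v => v \in [set at_ g | g in rot_orbit a b f])).
  by apply/imsetP; exists f; rewrite ?inE.
move=> u w /imsetP[g + ->] /existsP[h /and3P[hN /eqP hg /eqP <-]].
rewrite inE => fg; apply/imsetP.
case: (b_unique (f := g) (h := exist _ h hN) hg) => hE.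
  exists (b (a g)); last by rewrite at_b -hE.
  by rewrite inE (same_fconnect1_r (rot_inj aK bK)) rotV.
exists (rot a b g); last by rewrite /rot -hE.
by rewrite inE -(same_fconnect1_r (rot_inj aK bK)).
Qed.

(** Alternation of the colours at each vertex means that vertex and colour
    label the flags bijectively. *)
Lemma colouring_of_even :
    (forall v, ~~ odd #|black_cycle G v|) -> exists s, s \in colourings G.
Proof.
move=> even; have [e [e_a e_b]] : exists e : T -> bool,
    (forall f, e (a f) = e f) /\ (forall f, e (b f) = ~~ e f).
  apply: (alternating_colouring aK bK aN b_neq) => f.
  by rewrite order_black_cycle.
pose l (f : F) : option bool := if insub f is Some g then Some (e (g : T)) else None.
have l_black f (fN : f \notin red G) : l f = Some (e (exist _ f fN)).
  rewrite /l; case: insubP => [g gN gE|]; last by rewrite fN.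
  by congr (Some (e _)); apply: val_inj.
have l_red f : (l f == None) = (f \in red G).
  by rewrite /l; case: insubP => [g /negbTE -> //|]; rewrite negbK => ->.
have l_theta f : l (theta G f) = l f.
  rewrite /l; case: insubP => [g gN gE|]; case: insubP => [h hN hE|] //.
  - by rewrite -(e_a h); congr (Some (e _)); apply: val_inj; rewrite gE /= hE.
  - by rewrite negbK -theta_red (negbTE gN).
  - by rewrite negbK theta_red (negbTE hN).
have labI : injective (fun f => (attach G f, l f)).
  move=> f g [fg]; have [fr lE|fN] := boolP (f \in red G).
    have gr : g \in red G by rewrite -l_red -lE l_red.
    exact: red_flag_unique.
  move=> lE; have gN : g \notin red G by rewrite -l_red -lE l_red.
  move: lE; rewrite (l_black f fN) (l_black g gN) => -[].
  case: (b_unique (f := exist _ f fN) (h := exist _ g gN)) => [//|[]//|->].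
  by rewrite e_b; case: (e _).
have [q labK qK] := inj_card_bij labI (eq_leq (card_labelled_flags G)).
pose at_ f := attach G f.
have q_at x i : at_ (q (x, i)) = x by have [] := qK (x, i).
have q_l x i : l (q (x, i)) = i by have [] := qK (x, i).
pose m i x := at_ (theta G (q (x, i))).
have q_theta x i : theta G (q (x, i)) = q (m i x, i).
  by rewrite -[LHS]labK l_theta q_l.
have mK i : involutive (m i).
  by move=> x; rewrite {1}/m -q_theta thetaK q_at.
have m_fix i x : (m i x == x) = false && (i == Some true).
  apply/eqP => mx; have := q_theta x i; rewrite mx => /eqP.
  by rewrite (negbTE (theta_neq _)).
exists (build_system mK m_fix); apply/colouringP; exists q; split.
- by exists (fun f => (attach G f, l f)).
- by move=> x i; rewrite build_systemE.
- exact: q_at.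
- by move=> x i; rewrite -l_red q_l.
Qed.

End WithOther.

Lemma colourings_nonempty :
  black_even G = (0 < #|colourings G|)%N.
Proof.
apply/forall_inP/card_gt0P => [even|[s sG] C /black_cycleP[x ->]]; last first.
  exact: black_cycle_even sG x.
have [b bP] := fin_all_exists other_black_flag.
apply: (@colouring_of_even b) => [f|f|f h|v].
- by have [] := bP f.
- by have [] := bP f.
- by have [_ _] := bP f; apply.
- by apply: even; apply/black_cycleP; exists v.
Qed.

Lemma card_colourings_even :
  #|colourings G| = (black_even G * 2 ^ long_cycles G)%N.
Proof.
rewrite colourings_nonempty; have [|s0] := posnP #|colourings G|; first by move->.
by rewrite mul1n; have /card_gt0P[s sG] := s0; apply: card_colourings sG.
Qed.

End ColouringExistence.

(** * The logarithm *)
Lemma iso_connected (V F V' F' : finType) (G : flag_graph V F)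
  (H : flag_graph V' F') : iso G H -> connected G -> connected H.
Proof.
case=> fv [ff] [bv bf /is_morphP[H1 H2 _]] /andP[V0 /forallP conn].
rewrite /connected -(bij_eq_card bv) V0 /=; have [gv fvK gvK] := bv.
apply/forallP => u; apply/forallP => v.
have := forallP (conn (gv u)) (gv v).
rewrite -{2}[u]gvK -{2}[v]gvK; move: (gv u) (gv v) => x y.
case/connectP=> p xp ->; elim: p x xp => //= z p IHp x /andP[/existsP[f]].
case/andP=> /eqP <- /eqP <- /IHp; apply: connect_trans; apply: connect1.
by apply/existsP; exists (ff f); rewrite -H1 -!H2 !eqxx.
Qed.

Lemma connected_system o (V : finType) (s : edge_system o V) :
  connected (system_graph s) = sys_connected s.
Proof.
rewrite /connected /sys_connected; congr (_ && _).
have adjE : adj (system_graph s) =2 step s.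
  move=> x y; apply/existsP/existsP => [[[z i]]|[i /eqP <-]].
    by rewrite /= !ffunE /= => /andP[/eqP <- yE]; exists i.
  by exists (x, i); rewrite /= !ffunE !eqxx.
by apply: eq_forallb => x; apply: eq_forallb => y; rewrite (eq_connect adjE).
Qed.

Lemma mcoeff_fset_sum (R : nzRingType) (K : choiceType) (A : {fset K})
    (P : pred K) (w : K -> R) c :
  (\sum_(x <- A | P x) w x *: << x >> : {malg R[K]})@_c =
  if (c \in A) && P c then w c else 0.
Proof.
rewrite raddf_sum big_mkcond /=.
have E x : (if P x then (w x *: << x >> : {malg R[K]})@_c else 0) =
    (if P x then w x *+ (x == c) else 0).
  by rewrite mcoeffZ mcoeffU mulrnAr mulr1.
rewrite (eq_bigr _ (fun x _ => E x)); have [cA|cA] := boolP (c \in A).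
  rewrite (big_fsetD1 c) //= eqxx big1_fset ?addr0 // => x.
  by rewrite in_fsetD1 => /andP[/negbTE -> _] _; case: ifP.
by rewrite big1_fset // => x xA _; case: eqP xA cA => [-> ->|_ _ _] //; case: ifP.
Qed.

Section LogCoefficients.
Variable R : realType.
Implicit Type c : graph_class false.

Lemma mem_graph_systems c s : (s \in graph_systems (rep c)) = (sys_class s == c).
Proof.
rewrite inE; apply/existsP/eqP => [sp|sc].
  by rewrite -[RHS]gclass_rep; apply/gclassP/iso_presents.
by apply/iso_presents/gclassP; rewrite gclass_rep.
Qed.

Lemma conn_sum_coef c :
  (conn_sum R false 'I_(nvert c))@_c =
  (connected (rep c) * #|graph_systems (rep c)|)%:R.
Proof.
rewrite /conn_sum raddf_sum -sum1_card natrM natr_sum.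
rewrite mulr_sumr big_mkcond [RHS]big_mkcond; apply: eq_bigr => s _ /=.
rewrite mem_graph_systems mcoeffU -connected_system.
have [sc|_] := eqVneq; last by case: ifP.
suff -> : connected (system_graph s) = connected (rep c) by case: (connected _); rewrite ?mul1r ?mul0r.
have sG : iso (system_ctgraph s) (rep c) by apply/gclassP; rewrite gclass_rep.
by apply/idP/idP; apply: iso_connected => //; apply: iso_sym.
Qed.

Lemma card_Aut_bar_gt0 c : (0 < #|Aut_bar (rep c)|)%N.
Proof.
apply/card_gt0P; exists 1%g; rewrite inE; apply/existsP; exists 1%g.
by apply/is_morphP; split=> f; rewrite !perm1.
Qed.

Lemma log_coef c : ~~ odd (nvert c) ->
  weight R (nvert c)./2 * (conn_sum R false 'I_(nvert c))@_c =
  if connected (rep c) && black_even (rep c) then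
    (-1) ^+ (nvert c)./2 * (2 ^+ long_cycles (rep c) / #|Aut_bar (rep c)|%:R)
  else 0.
Proof.
move=> c_even; rewrite conn_sum_coef.
have [cc|_] := boolP (connected _); last by rewrite mul0n mulr0.
have := card_graph_systems (rep c); rewrite card_colourings_even card_ord.
rewrite /weight even_halfK // mul1n => E.
have A0 : #|Aut_bar (rep c)|%:R != 0 :> R.
  by rewrite pnatr_eq0 -lt0n card_Aut_bar_gt0.
have f0 : (nvert c)`!%:R != 0 :> R by rewrite pnatr_eq0 -lt0n fact_gt0.
have -> : #|graph_systems (rep c)|%:R =
    (nvert c)`!%:R * (black_even (rep c) * 2 ^ long_cycles (rep c))%:R
      / #|Aut_bar (rep c)|%:R :> R.
  by rewrite -natrM -E natrM mulfK.
rewrite -!mulrA mulKf //.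
by case: (black_even _); rewrite ?mul1n ?natrX // mul0n mul0r mulr0.
Qed.

Lemma conn_series_log : conn_series R false = log_series R.
Proof.
apply: completion_eq => n; rewrite conn_seriesE; apply/malgP => c.
rewrite mcoeffZ [RHS]mcoeff_fset_sum mem_Gamma mul2n.
have [cn|cn] := eqVneq (nvert c) n.*2.
  have c2 : (nvert c)./2 = n by rewrite cn doubleK.
  by rewrite andTb -log_coef; [rewrite c2 cn | rewrite cn odd_double].
rewrite /conn_sum raddf_sum big1 ?mulr0 // => s _ /=.
rewrite mcoeffU; have [sc|//] := eqVneq (sys_class s) c.
by case/eqP: cn; rewrite -sc nvert_sys_class card_ord.
Qed.

End LogCoefficients.

Theorem lemma5p5 (R : realType) : Psi R = compl_exp (log_series R).
Proof.
rewrite /Psi -conn_series_cycle -exponential_formula closure_sys_series.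
by rewrite exponential_formula conn_series_log.
Qed.
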